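(* Let $H$ be a monoid and let $r$ be a finitary ideal system on $H$. The following are equivalent: (1) $H$ is an $r$-Bézout $r$-SP-monoid (i.e. both an $r$-Bézout monoid and an $r$-SP-monoid). (2) $H$ is a radical factorial $r$-Bézout monoid. (3) $H$ is $r$-treed, $\mathcal{C}_r(H)$ is trivial and every nontrivial prime $r$-ideal of $H$ contains a nontrivial radical principal ideal of $H$. (4) $H$ satisfies the $r$-prime power condition, $H$ is primary $r$-ideal inclusive and the radical of every principal ideal of $H$ is principal. (5) $H$ is $r$-treed and the radical of every principal ideal of $H$ is principal. (6) $\mathcal{P}(I)\subseteq\mathfrak{X}(H)$ for every nontrivial $r$-finitely generated $r$-ideal $I$ of $H$ and the radical of every principal ideal of $H$ is principal. (7) The radical of every $r$-finitely generated $r$-ideal of $H$ is principal.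
   Context: Monoids. A monoid $H$ is a commutative semigroup with identity and more than one element in which every nonzero element is cancellative. Here $z(H)=\{z\in H: zx=z \text{ for all } x\in H\}$ is the set of zero elements ($|z(H)|\le 1$, possibly empty); ''nonzero'' means not in $z(H)$; $H^{\bullet}=H\setminus z(H)$; $G=(H^{\bullet})^{-1}H$ is the quotient monoid; $\mathbb{N}$ is the set of positive integers. For $X\subseteq H$, $\sqrt X=\{x\in H: x^n\in X\text{ for some }n\in\mathbb{N}\}$; for $Y\subseteq G$, $Y^{-1}=\{z\in G: zY\subseteq H\}$. Ideals. $X\subseteq H$ is an $s$-ideal if $X=XH\cup z(H)$; it is radical if $\sqrt X=X$; nontrivial if $z(H)\subsetneq X$; proper if $X\ne H$. A principal ideal is a set $AH\cup z(H)$ with $A\subseteq H$, $|A|\le 1$. A prime $s$-ideal is a proper $s$-ideal $P$ such that $xy\in P$ implies $x\in P$ or $y\in P$; a proper $s$-ideal $I$ is primary if $xy\in I$, $x\notin I$ imply $y\in\sqrt I$. $\mathfrak{X}(H)$ is the set of minimal elements among the prime $s$-ideals properly containing $z(H)$; $\mathcal{P}(X)$ is the set of prime $s$-ideals minimal above $X$. Ideal systems. A finitary ideal system on $H$ is a map $r:\mathbb{P}(H)\to\mathbb{P}(H)$, $X\mapsto X_r$ ($\mathbb{P}$ = power set) such that for all $X,Y\subseteq H$, $c\in H$: $XH\cup z(H)\subseteq X_r$; $X\subseteq Y_r$ implies $X_r\subseteq Y_r$; $cX_r=(cX)_r$; $X_r=\bigcup_{E\subseteq X,|E|<\infty}E_r$.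 An $r$-ideal is an $X\subseteq H$ with $X_r=X$; it is $r$-invertible if $(XX^{-1})_r=H$; an $r$-ideal $I$ is $r$-finitely generated if $I=E_r$ for some finite $E\subseteq I$. Prime/primary $r$-ideals are $r$-ideals that are prime/primary $s$-ideals. The $r$-product of $r$-ideals $I,J$ is $(IJ)_r$ (similarly for finitely many factors), and $r$-powers are $(I^k)_r$, $k\in\mathbb{N}$. $r$-$\max(H)$ is the set of maximal elements among the proper $r$-ideals. $\mathcal{C}_r(H)$ ($r$-class group) is the quotient group of the monoid of $r$-invertible $r$-ideals (under $r$-multiplication) modulo the quotient group of the monoid of nontrivial principal ideals; it is trivial iff every $r$-invertible $r$-ideal is principal. Properties. $H$ is an $r$-SP-monoid if every $r$-ideal of $H$ is a finite $r$-product of radical $r$-ideals. $H$ is radical factorial if every principal ideal is a finite product of radical principal ideals. $H$ is an $r$-Bézout monoid if every nontrivial $r$-finitely generated $r$-ideal is principal. $H$ is $r$-treed if for all $M\in r$-$\max(H)$ the prime $r$-ideals contained in $M$ form a chain. $H$ satisfies the $r$-prime power condition if every primary $r$-ideal of $H$ is an $r$-power of its radical. $H$ is primary $r$-ideal inclusive if for all prime $r$-ideals $P\subsetneq Q$ there is a primary $r$-ideal $I$ with $P\subseteq I\subsetneq\sqrt I\subseteq Q$. *)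

(* Defs.v *)
From HB Require Import structures.
From mathcomp Require Import all_boot.
From mathcomp Require Import boolp classical_sets functions cardinality.

Set Implicit Arguments.
Unset Strict Implicit.
Unset Printing Implicit Defensive.

Local Open Scope classical_set_scope.
Local Open Scope group_scope.
Local Open Scope quotient_scope.

(* A commutative monoid in the usual sense; in the theory of ideal systems,
   'monoid' means the stronger structure [cancMonoidType] defined below. *)
HB.mixin Record Monoid_isCommutative M & Monoid M := {
  mulgC : @commutative M M *%g
}.

#[short(type="comMonoidType")]
HB.structure Definition ComMonoid := {M of Monoid_isCommutative M & Monoid M}.

HB.instance Definition _ (M : comMonoidType) :=
  SemiGroup.isCommutativeLaw.Build M *%g mulgC.

Definition zeros (M : magmaType) : set M := [set z | forall x, z * x = z].
Arguments zeros M : clear implicits.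

HB.mixin Record ComMonoid_isCancellative H & ComMonoid H := {
  exists_neq1 : exists x : H, x <> 1;
  nonzero_mulgI : forall a : H, ~ zeros H a -> injective (mul a)
}.

#[short(type="cancMonoidType")]
HB.structure Definition CancMonoid :=
  {H of ComMonoid_isCancellative H & ComMonoid H}.

Arguments nonzero_mulgI {H} [a] _ [x1 x2] : rename.

Definition mulset (M : magmaType) (X Y : set M) : set M :=
  [set x * y | x in X & y in Y].

Section Localization.
Variables (M : comMonoidType) (S : umagmaClosed M).

Record prefrac := Prefrac { prefrac_val :> M * M; _ : prefrac_val.2 \in S }.

HB.instance Definition _ := [isSub for prefrac_val].
HB.instance Definition _ := [Choice of prefrac by <:].

(* The factor [u] is superfluous when the elements of [S] are cancellative. *)
Definition frac_equiv (p q : prefrac) : bool :=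
  `[< exists2 u, u \in S & u * (p.1 * q.2) = u * (q.1 * p.2) >].

Lemma prefrac_den (p : prefrac) : p.2 \in S. Proof. by case: p. Qed.

Lemma frac_equiv_refl : reflexive frac_equiv.
Proof. by move=> p; apply/asboolP; exists 1; rewrite ?gpred1. Qed.

Lemma frac_equiv_sym : symmetric frac_equiv.
Proof.
by move=> p q; apply/asboolP/asboolP => -[u Su e]; exists u => //; rewrite e.
Qed.

Lemma frac_equiv_trans : transitive frac_equiv.
Proof.
move=> q p s /asboolP[u Su e] /asboolP[v Sv f]; apply/asboolP.
exists (u * v * q.2); first by rewrite !gpredM ?prefrac_den.
rewrite [LHS](AC (3*2) ((2*5)*(1*(4*3)))) /=. rewrite e.
rewrite [LHS](AC (2*(1*2)) ((3*5)*(1*(4*2)))) /= f.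
by rewrite [LHS](AC (2*(1*2)) ((1*3*5)*(4*2))).
Qed.

Canonical frac_equiv_equiv :=
  EquivRel frac_equiv frac_equiv_refl frac_equiv_sym frac_equiv_trans.

Definition localization := {eq_quot frac_equiv}.

HB.instance Definition _ := Choice.on localization.
HB.instance Definition _ := EqQuotient.on localization.

Fact mul_prefrac_subproof (p q : prefrac) : (p.1 * q.1, p.2 * q.2).2 \in S.
Proof. by rewrite /= gpredM ?prefrac_den. Qed.

Definition mul_prefrac (p q : prefrac) : prefrac :=
  Prefrac (mul_prefrac_subproof p q).

Fact embed_subproof (x : M) : (x, 1).2 \in S.
Proof. exact: gpred1. Qed.

Definition loc_embed (x : M) : localization := \pi_localization (Prefrac (embed_subproof x)).

Definition loc_mul : localization -> localization -> localization :=
  fun z w => \pi_localization (mul_prefrac (repr z) (repr w)).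

Lemma pi_mul (p q : prefrac) :
  loc_mul (\pi p) (\pi q) = \pi_localization (mul_prefrac p q).
Proof.
apply/eqmodP/asboolP => /=.
case: piP => p' /eqmodP/asboolP[u Su e]; case: piP => q' /eqmodP/asboolP[v Sv f].
exists (u * v); rewrite ?gpredM //=.
rewrite [LHS](AC (2*(2*2)) ((1*(3*5))*(2*(4*6)))) /= -e -f.
by rewrite [LHS](AC ((1*2)*(1*2)) ((1*4)*((2*5)*(3*6)))).
Qed.

Fact loc_mulA : associative loc_mul.
Proof.
move=> x y z; rewrite -[x]reprK -[y]reprK -[z]reprK !pi_mul; congr \pi_localization.
by apply: val_inj; rewrite /= !mulgA.
Qed.

Fact loc_mulC : commutative loc_mul.
Proof.
move=> x y; rewrite -[x]reprK -[y]reprK !pi_mul; congr \pi_localization.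
by apply: val_inj; rewrite /= mulgC [in X in (_, X)]mulgC.
Qed.

Fact loc_mul1 : left_id (loc_embed 1) loc_mul.
Proof.
move=> x; rewrite -[x]reprK pi_mul; congr \pi_localization.
by apply: val_inj; rewrite /= !mul1g; case: (val _).
Qed.

Fact loc_mulr1 : right_id (loc_embed 1) loc_mul.
Proof. by move=> x; rewrite loc_mulC loc_mul1. Qed.

HB.instance Definition _ :=
  isMonoid.Build localization loc_mulA loc_mul1 loc_mulr1.
HB.instance Definition _ := Monoid_isCommutative.Build localization loc_mulC.

Lemma loc_embedM : {morph loc_embed : x y / x * y}.
Proof.
move=> x y; rewrite [RHS]pi_mul; congr \pi_localization.
by apply: val_inj; rewrite /= mul1g.
Qed.

Lemma loc_clear (z : localization) :
  exists s x, s \in S /\ loc_embed s * z = loc_embed x.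
Proof.
exists (repr z).2, (repr z).1; split; first exact: prefrac_den.
rewrite -{2}[z]reprK [LHS]pi_mul; apply/eqmodP/asboolP.
exists 1; rewrite ?gpred1 //=.
by rewrite !mul1g mulg1 mulgC.
Qed.

Lemma loc_embed_inj_mul (s : M) :
  s \in S -> injective (mul (loc_embed s)).
Proof.
move=> Ss; have Ss' : (1 : M, s).2 \in S by [].
have inv1 : \pi_localization (Prefrac Ss') * loc_embed s = 1.
  rewrite [LHS]pi_mul; apply/eqmodP/asboolP; exists 1; rewrite ?gpred1 //=.
  by rewrite !mulg1.
by move=> x y e; rewrite -[x]mul1g -[y]mul1g -inv1 -!mulgA e.
Qed.

End Localization.

Section QuotientMonoid.
Variable H : cancMonoidType.
Implicit Types (X Y : set H).

Definition nonzero : {pred H} := [pred x | `[< ~ zeros H x >]].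

Fact nonzero_mul : mulg_closed nonzero.
Proof.
move=> x y /asboolP nx /asboolP ny; apply/asboolP => xy0; apply: ny => z.
by apply: (nonzero_mulgI nx); rewrite mulgA xy0.
Qed.

Fact nonzero_one : 1 \in nonzero.
Proof.
apply/asboolP => z1; have [x] := @exists_neq1 H; apply.
by rewrite -(z1 x) mul1g.
Qed.

HB.instance Definition _ := isMulClosed.Build H nonzero nonzero_mul.
HB.instance Definition _ := isMul1Closed.Build H nonzero nonzero_one.

Definition quotient_monoid := localization nonzero.
HB.instance Definition _ := ComMonoid.on quotient_monoid.

Definition tofrac : H -> quotient_monoid := @loc_embed H nonzero.

Lemma tofrac_inj : injective tofrac.
Proof.
move=> x y /eqmodP/asboolP[u /asboolP nu] /= /(nonzero_mulgI nu).
by rewrite !mulg1.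
Qed.

Lemma tofracM : {morph tofrac : x y / x * y}.
Proof. exact: loc_embedM. Qed.

(* Y^{-1}, where H is identified with the range of the injection [tofrac] *)
Definition inv_set (Y : set quotient_monoid) : set quotient_monoid :=
  [set z | [set z * y | y in Y] `<=` range tofrac].

(* X X^{-1}; it is contained in H, so it is pulled back along [tofrac] *)
Definition mul_inv_set X : set H :=
  tofrac @^-1` mulset (tofrac @` X) (inv_set (tofrac @` X)).

End QuotientMonoid.

Section SIdeals.
Variable H : cancMonoidType.
Implicit Types (X Y I J P Q : set H).

Definition radical X : set H := [set x | exists2 n, (0 < n)%N & X (x ^+ n)].
Definition is_radical X := radical X = X.

Definition s_ideal X := X = mulset X setT `|` zeros H.
Definition nontrivial X := zeros H `<` X.
Definition proper_set X := X <> setT.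

Definition principal I :=
  exists2 A : set H, is_subset1 A & I = mulset A setT `|` zeros H.

Definition prime_s_ideal P :=
  [/\ s_ideal P, proper_set P & forall x y, P (x * y) -> P x \/ P y].

Definition primary_s_ideal I :=
  [/\ s_ideal I, proper_set I
    & forall x y, I (x * y) -> ~ I x -> radical I y].

Definition minimals (F : set (set H)) : set (set H) :=
  [set P | F P /\ forall Q, F Q -> Q `<=` P -> Q = P].

Definition maximals (F : set (set H)) : set (set H) :=
  [set P | F P /\ forall Q, F Q -> P `<=` Q -> Q = P].

(* usually written \mathfrak{X}(H) *)
Definition height_one_primes : set (set H) :=
  minimals [set P | prime_s_ideal P /\ zeros H `<` P].

(* usually written \mathcal{P}(X) *)
Definition minimal_primes X : set (set H) :=
  minimals [set P | prime_s_ideal P /\ X `<=` P].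

(* For the empty list this is [set 1], whose r-closure is H. *)
Definition prodset (s : seq (set H)) : set H :=
  \big[@mulset H/[set 1]]_(X <- s) X.

Definition powset X (k : nat) : set H := prodset (nseq k X).

End SIdeals.

Arguments height_one_primes H : clear implicits.

Record finitary_ideal_system (H : cancMonoidType) := FinitaryIdealSystem {
  closure :> set H -> set H;
  closure_ext : forall X, mulset X setT `|` zeros H `<=` closure X;
  closure_min : forall X Y, X `<=` closure Y -> closure X `<=` closure Y;
  closureZ : forall c X, mul c @` closure X = closure (mul c @` X);
  closure_finitary : forall X,
    closure X = \bigcup_(E in [set E | E `<=` X /\ finite_set E]) closure E
}.

Section RIdeals.
Variables (H : cancMonoidType) (r : finitary_ideal_system H).
Implicit Types (X Y I J P Q : set H).

Definition r_ideal X := r X = X.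

Definition r_invertible X := r (mul_inv_set X) = setT.

Definition r_finitely_generated I :=
  exists E, [/\ finite_set E, E `<=` I & I = r E].

Definition prime_r_ideal P := r_ideal P /\ prime_s_ideal P.
Definition primary_r_ideal I := r_ideal I /\ primary_s_ideal I.

Definition r_max : set (set H) :=
  maximals [set I | r_ideal I /\ proper_set I].

Definition r_SP_monoid :=
  forall I, r_ideal I ->
    exists2 s : seq (set H),
      (forall J, J \in s -> r_ideal J /\ is_radical J) & I = r (prodset s).

Definition r_Bezout_monoid :=
  forall I, r_ideal I -> nontrivial I -> r_finitely_generated I -> principal I.

Definition r_treed :=
  forall M, r_max M ->
    forall P Q, prime_r_ideal P -> prime_r_ideal Q ->
      P `<=` M -> Q `<=` M -> P `<=` Q \/ Q `<=` P.

Definition r_prime_power_condition :=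
  forall I, primary_r_ideal I ->
    exists2 k, (0 < k)%N & I = r (powset (radical I) k).

Definition primary_r_ideal_inclusive :=
  forall P Q, prime_r_ideal P -> prime_r_ideal Q -> P `<` Q ->
    exists I, [/\ primary_r_ideal I, P `<=` I, I `<` radical I
                & radical I `<=` Q].

End RIdeals.

Definition radical_factorial (H : cancMonoidType) :=
  forall I : set H, principal I ->
    exists2 s : seq (set H),
      (forall J, J \in s -> principal J /\ is_radical J) & I = prodset s.

Section ClassGroup.
Variables (H : cancMonoidType) (r : finitary_ideal_system H).
Implicit Types (X Y Z I J : set H).

Lemma sub_closure X : X `<=` r X.
Proof.
move=> x Xx; apply: closure_ext; left.
by exists x => //; exists 1 => //; rewrite mulg1.
Qed.

Lemma closure_mono X Y : X `<=` Y -> r X `<=` r Y.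
Proof. by move=> XY; apply: closure_min => x /XY; apply: sub_closure. Qed.

Lemma r_ideal_closure X : r_ideal r (r X).
Proof.
by apply/seteqP; split; [apply: closure_min | apply: sub_closure].
Qed.

Lemma r_ideal_setT : r_ideal r setT.
Proof. by apply/seteqP; split => // x _; apply: sub_closure. Qed.

Lemma mulsetC X Y : mulset X Y = mulset Y X.
Proof.
by apply/seteqP; split => _ [x Xx] [y Yy] <-;
  exists y => //; exists x => //; rewrite mulgC.
Qed.

Lemma mulsetA X Y Z : mulset X (mulset Y Z) = mulset (mulset X Y) Z.
Proof.
apply/seteqP; split.
  move=> _ [x Xx] [_ [y Yy] [z Zz] <-] <-; exists (x * y).
    by exists x => //; exists y.
  by exists z => //; rewrite mulgA.
move=> _ [_ [x Xx] [y Yy] <-] [z Zz] <-; exists x => //; exists (y * z).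
  by exists y => //; exists z.
by rewrite mulgA.
Qed.

Lemma closure_mulr X Y : r (mulset X (r Y)) = r (mulset X Y).
Proof.
apply/seteqP; split.
  apply: closure_min => _ [x Xx] [y rYy] <-.
  have : (mul x @` r Y) (x * y) by exists y.
  rewrite closureZ; apply: closure_mono => _ [y' Yy' <-].
  by exists x => //; exists y'.
apply: closure_mono => _ [x Xx] [y Yy] <-; exists x => //.
by exists y => //; apply: sub_closure.
Qed.

Lemma closure_mull X Y : r (mulset (r X) Y) = r (mulset X Y).
Proof. by rewrite mulsetC closure_mulr mulsetC. Qed.

Lemma mulset_setT : mulset setT setT = setT :> set H.
Proof.
by apply/seteqP; split => // x _; exists x => //; exists 1 => //; rewrite mulg1.
Qed.

Lemma closure_mulT I : r_ideal r I -> r (mulset I setT) = I.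
Proof.
move=> rI; apply/seteqP; split.
  rewrite -{2}rI -(r_ideal_closure I); apply: closure_mono => x Ix.
  by apply: closure_ext; left.
rewrite -{1}rI; apply: closure_mono => x Ix.
by exists x => //; exists 1 => //; rewrite mulg1.
Qed.

Lemma r_invertible_setT : r_invertible r setT.
Proof.
apply/seteqP; split => // x _; apply: closure_ext; left.
exists 1; last by exists x => //; rewrite mul1g.
exists (tofrac 1); first by exists 1.
exists 1; last by rewrite mulg1.
by move=> _ [_ [y _ <-] <-]; exists y => //; rewrite mul1g.
Qed.

Lemma r_invertible_mul I J :
  r_invertible r I -> r_invertible r J -> r_invertible r (r (mulset I J)).
Proof.
move=> invI invJ; apply/seteqP; split => // t _.
suff : r (mulset (mul_inv_set I) (mul_inv_set J)) `<=`
       r (mul_inv_set (r (mulset I J))).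
  by apply; rewrite -closure_mulr -closure_mull invI invJ mulset_setT
    r_ideal_setT.
apply: closure_mono.
move=> _ [a [_ [i Ii <-] [z zI /= ea]] [b [_ [j Jj <-] [w wJ /= eb]] <-]].
rewrite /mul_inv_set /= tofracM -ea -eb.
exists (tofrac (i * j)).
  by exists (i * j) => //; apply: sub_closure; exists i => //; exists j.
exists (z * w); last first.
  by rewrite tofracM [RHS](AC (2*2) ((1*3)*(2*4))).
move=> _ [_ [k Kk <-] <-] /=.
have [s [u [Ss eu]]] := loc_clear (z * w).
have {}eu : tofrac s * (z * w) = tofrac u by [].
have : (mul u @` r (mulset I J)) (u * k) by exists k.
rewrite closureZ => uk.
have sub : mul u @` mulset I J `<=` mul s @` setT.
  move=> _ [_ [i' Ii'] [j' Jj'] <-] <-.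
  have [h1 _ e1] : range (@tofrac H) (z * tofrac i').
    by apply: zI; exists (tofrac i') => //; exists i'.
  have [h2 _ e2] : range (@tofrac H) (w * tofrac j').
    by apply: wJ; exists (tofrac j') => //; exists j'.
  exists (h1 * h2) => //; apply: (@tofrac_inj H).
  rewrite !tofracM e1 e2 -eu.
  by rewrite [LHS](AC (1*(2*2)) (1*((2*4)*(3*5)))) /= !mulgA.
move/(closure_mono sub) : uk; rewrite -closureZ => -[h _ eh].
exists h => //; apply: (loc_embed_inj_mul Ss).
change (tofrac s * tofrac h = tofrac s * (z * w * tofrac k)).
by rewrite -tofracM eh tofracM -eu -!mulgA.
Qed.

Definition invertible_pred : {pred set H} :=
  [pred I | `[< r_ideal r I /\ r_invertible r I >]].

Record invertible_ideal := InvertibleIdeal {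
  ideal_set :> set H; _ : invertible_pred ideal_set
}.

HB.instance Definition _ := [isSub for ideal_set].
HB.instance Definition _ := [Choice of invertible_ideal by <:].

Lemma invertible_idealP (I : invertible_ideal) :
  r_ideal r I /\ r_invertible r I.
Proof. by have /asboolP := valP I. Qed.

Fact one_ideal_subproof : invertible_pred setT.
Proof.
by apply/asboolP; split; [exact: r_ideal_setT | exact: r_invertible_setT].
Qed.

Fact mul_ideal_subproof (I J : invertible_ideal) :
  invertible_pred (r (mulset I J)).
Proof.
have [_ invI] := invertible_idealP I; have [_ invJ] := invertible_idealP J.
by apply/asboolP; split; [exact: r_ideal_closure | exact: r_invertible_mul].
Qed.

Definition one_ideal := InvertibleIdeal one_ideal_subproof.

Definition mul_ideal (I J : invertible_ideal) :=
  InvertibleIdeal (mul_ideal_subproof I J).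

Fact mul_idealC : commutative mul_ideal.
Proof. by move=> I J; apply: val_inj; rewrite /= mulsetC. Qed.

Fact mul_idealA : associative mul_ideal.
Proof.
by move=> I J K; apply: val_inj; rewrite /= closure_mulr closure_mull mulsetA.
Qed.

Fact mul_ideal1 : right_id one_ideal mul_ideal.
Proof.
move=> I; apply: val_inj; apply: closure_mulT.
by have [] := invertible_idealP I.
Qed.

Fact mul_1ideal : left_id one_ideal mul_ideal.
Proof. by move=> I; rewrite mul_idealC mul_ideal1. Qed.

HB.instance Definition _ :=
  isMonoid.Build invertible_ideal mul_idealA mul_1ideal mul_ideal1.
HB.instance Definition _ :=
  Monoid_isCommutative.Build invertible_ideal mul_idealC.

Definition full_pred : {pred invertible_ideal} := predT.

HB.instance Definition _ := isMulClosed.Build invertible_ideal full_pred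
  (fun _ _ _ _ => isT).
HB.instance Definition _ := isMul1Closed.Build invertible_ideal full_pred isT.

Definition invertible_quotient_group := localization full_pred.
HB.instance Definition _ := ComMonoid.on invertible_quotient_group.

(* The quotient group of the monoid of nontrivial principal ideals, as a
   subgroup: the fractions z = I / J, characterized by z * J = I. *)
Definition principal_fractions : set invertible_quotient_group :=
  [set z | exists I J : invertible_ideal,
     [/\ nontrivial I, principal I, nontrivial J, principal J
       & z * loc_embed full_pred J = loc_embed full_pred I]].

Definition class_of (z : invertible_quotient_group) :=
  mul z @` principal_fractions.

(* Only the underlying set of cosets of C_r(H) is needed to state that the
   group is trivial, i.e. that the subgroup itself is the only coset. *)
Definition class_group : set (set invertible_quotient_group) := range class_of.

Definition class_group_trivial := class_group = [set principal_fractions].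

End ClassGroup.

(* Main.v *)
Require Import Defs.
From HB Require Import structures.
From mathcomp Require Import all_boot.
From mathcomp Require Import boolp classical_sets functions cardinality.

(** The seven conditions are closed into a cycle, in the order in which they are
    listed.  Fractions occur only in the definitions of invertibility and of the
    class group; everything else is divisibility in [H], and statements about the
    localization at a prime [L] are expressed by multipliers [s] outside [L].
    The main tool is [local_radical]: if all the prime [r]-ideals between [y] and
    [L] contain [x], then some [s * x ^+ n] with [s] outside [L] is a multiple
    of [y].

    In a Bezout monoid, an [r]-factor of a principal ideal is finitely generated
    and hence principal ([factor_principal]); so factorizations into radical
    [r]-ideals become factorizations into radical elements.  A Bezout monoid is
    treed and its invertible ideals are principal.

    If [H] is treed and its nontrivial primes contain radical elements, then all
    these primes are maximal ([treed_radical_max]), and a radical [b] in [M] is a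
    uniformizer of the localization at [M], which is a discrete valuation monoid.
    There an equation [s * b ^+ n = a * h] with [s] and [h] outside [M] shows both
    that the radical of [a H] is invertible and that primary ideals are powers of
    their radicals.

    Once radicals of principal ideals are principal, a prime that is minimal over
    a radical element has height one ([minimal_over_radical]).  The prime power
    condition produces such primes above any nontrivial prime which is not
    maximal, so that [H] is treed; and in a treed monoid a prime minimal over a
    finitely generated ideal is minimal over one of the generators.  If minimal
    primes of finitely generated ideals have height one, the radical of the ideal
    of two radical elements [x] and [y] is the radical of their product divided
    by their least common multiple, which is the radical of [x * y]
    ([radical_pair_principal]).

    Suppose finally that radicals of finitely generated ideals are principal.
    Then all nontrivial primes are maximal ([fg_radicals_dim1]), and dividing a
    nonzero [a] by the generator of its radical, again and again, ends with a
    unit ([iter_reaches_unit]).  The same process applied to a finitely generated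
    ideal is controlled by any nonzero member [a], so the ideal is principal; and
    applied to all members of an [r]-ideal [I] it splits off the radical of [I]
    as an [r]-factor, which gives a finite factorization into radicals. *)

Set Implicit Arguments.
Unset Strict Implicit.
Unset Printing Implicit Defensive.

Local Open Scope classical_set_scope.

(** * Divisibility *)

Section Divisibility.
Local Open Scope group_scope.
Variable H : cancMonoidType.
Implicit Types (a b c d e g h s t x y z : H) (X Y : set H).

Lemma mulgCA x y z : x * (y * z) = y * (x * z).
Proof. by rewrite mulgA (mulgC x) -mulgA. Qed.

Lemma mulgAC x y z : x * y * z = x * z * y.
Proof. by rewrite -mulgA (mulgC y) mulgA. Qed.

Lemma mulgACA x y z t : (x * y) * (z * t) = (x * z) * (y * t).
Proof. by rewrite -!mulgA (mulgCA y). Qed.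

Lemma expgMc x y n : (x * y) ^+ n = x ^+ n * y ^+ n.
Proof. by apply: expgMn; exact: mulgC. Qed.

Lemma zerosMl x y : zeros H x -> zeros H (x * y).
Proof. by move=> zx; rewrite zx. Qed.

Lemma zerosMr x y : zeros H x -> zeros H (y * x).
Proof. by rewrite mulgC; apply: zerosMl. Qed.

Lemma nz1 : ~ zeros H 1.
Proof. by have /asboolP := nonzero_one H. Qed.

Lemma nzM x y : ~ zeros H x -> ~ zeros H y -> ~ zeros H (x * y).
Proof.
by move=> /asboolP nx /asboolP ny; apply/asboolP/(@nonzero_mul H).
Qed.

Lemma nzX x n : ~ zeros H x -> ~ zeros H (x ^+ n).
Proof.
move=> nx; elim: n => [|n IHn]; first by rewrite expg0; exact: nz1.
by rewrite expgS; exact: nzM.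
Qed.

Lemma nzMl x y : ~ zeros H (x * y) -> ~ zeros H x.
Proof. by move=> n zx; apply: n; apply: zerosMl. Qed.

Lemma nzMr x y : ~ zeros H (x * y) -> ~ zeros H y.
Proof. by move=> n zx; apply: n; apply: zerosMr. Qed.

(** The principal ideal [a H]; since a zero element is a multiple of every
    element, the union with [zeros H] is automatic here. *)
Definition mults a : set H := mul a @` setT.

Lemma multsP a x : mults a x <-> exists h, x = a * h.
Proof. by split=> [[h _ <-]|[h ->]]; exists h. Qed.

Lemma mults_mul a h : mults a (a * h).
Proof. by exists h. Qed.

Lemma mults_refl a : mults a a.
Proof. by exists 1 => //; rewrite mulg1. Qed.

Lemma multsM a x y : mults a x -> mults a (x * y).
Proof. by move=> [h _ <-]; rewrite -mulgA; exact: mults_mul. Qed.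

Lemma mults_trans a b x : mults a b -> mults b x -> mults a x.
Proof. by move=> ab [h _ <-]; apply: multsM. Qed.

Lemma mults_sub a b : mults a b -> mults b `<=` mults a.
Proof. by move=> ab x; apply: mults_trans. Qed.

Lemma mults1 x : mults 1 x.
Proof. by exists x => //; rewrite mul1g. Qed.

Lemma mults_setT a : mults a 1 -> mults a = setT.
Proof. by move=> a1; apply/seteqP; split=> // x _;
  apply: (mults_trans a1 (mults1 x)). Qed.

Lemma zeros_mults a : zeros H `<=` mults a.
Proof. by move=> z zz; exists z => //; rewrite mulgC zz. Qed.

Lemma mults_zero a : zeros H a -> mults a = zeros H.
Proof.
move=> za; apply/seteqP; split; last exact: zeros_mults.
by move=> _ [h _ <-]; apply: zerosMl.
Qed.

Lemma principal_mults a : principal (mults a).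
Proof.
exists [set a]; first by move=> x y -> ->.
apply/seteqP; split=> [_ [h _ <-]|x [[_ -> [h _ <-]]|zx]].
- by left; exists a => //; exists h.
- exact: mults_mul.
- exact: zeros_mults.
Qed.

Lemma principal_zeros : principal (zeros H).
Proof.
exists set0; first by move=> x y [].
by apply/seteqP; split=> [x zx|x [[? []]|//]]; right.
Qed.

Lemma principalP I : principal I -> I = zeros H \/ exists a, I = mults a.
Proof.
move=> [A sA ->]; have [->|/set0P[a Aa]] := eqVneq A set0.
  by left; apply/seteqP; split=> [x [[? []]|//]|x zx]; right.
right; exists a; apply/seteqP; split=> [x [[b Ab [h _ <-]]|zx]|_ [h _ <-]].
- by rewrite (sA _ _ Ab Aa); exact: mults_mul.
- exact: zeros_mults.
- by left; exists a => //; exists h.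
Qed.

Lemma nontrivialP X : zeros H `<=` X ->
  nontrivial X <-> exists2 x, X x & ~ zeros H x.
Proof.
move=> zX; split=> [[_ nX]|[x Xx nx]].
  by apply: contrapT => nex; apply: nX => x Xx; apply: contrapT => nx;
    apply: nex; exists x.
by split=> // Xz; apply/nx/Xz.
Qed.

Lemma nontrivial_mults a : nontrivial (mults a) -> ~ zeros H a.
Proof. by move=> [_ n] za; apply: n; rewrite mults_zero. Qed.

Lemma trivialP X : zeros H `<=` X -> ~ nontrivial X -> X = zeros H.
Proof.
move=> zX nX; apply/seteqP; split=> // x Xx; apply: contrapT => nx.
by apply: nX; apply/(nontrivialP zX); exists x.
Qed.

Lemma principal_nontrivial I : principal I -> nontrivial I ->
  exists2 a, ~ zeros H a & I = mults a.
Proof.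
move=> /principalP[->[_ nI]|[a ->] na]; first by case: nI.
by exists a => //; exact: nontrivial_mults.
Qed.

Lemma mults_pmul c a x : ~ zeros H c -> mults (c * a) (c * x) -> mults a x.
Proof.
move=> nc [h _]; rewrite /= -mulgA => /(nonzero_mulgI nc) <-.
exact: mults_mul.
Qed.

Lemma mults_mul2 c a x : mults a x -> mults (c * a) (c * x).
Proof. by move=> [h _ <-]; rewrite mulgA; exact: mults_mul. Qed.

Lemma mults_mulM a b x y : mults a x -> mults b y -> mults (a * b) (x * y).
Proof. by move=> [h _ <-] [g _ <-]; rewrite mulgACA; exact: mults_mul. Qed.

Lemma sub_radical X : X `<=` radical X.
Proof. by move=> x Xx; exists 1%N. Qed.

Lemma radical_mono X Y : X `<=` Y -> radical X `<=` radical Y.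
Proof. by move=> XY x [n n0 Xx]; exists n => //; apply: XY. Qed.

Lemma radical_idem X : is_radical (radical X).
Proof.
apply/seteqP; split; last exact: sub_radical.
move=> x [n n0 [m m0 Xx]]; exists (n * m)%N; first by rewrite muln_gt0 n0.
by rewrite expgnA.
Qed.

Lemma radical_zeros : is_radical (zeros H).
Proof.
apply/seteqP; split; last exact: sub_radical.
by move=> x [n _ zx]; apply: contrapT => nx; apply: nzX zx.
Qed.

Lemma exp_mem X x n m : (forall x y, X x -> X (x * y)) -> X (x ^+ n) ->
  (n <= m)%N -> X (x ^+ m).
Proof. by move=> XM Xx /subnKC <-; rewrite expgnDr; apply: XM. Qed.

Lemma is_radicalP X x n : is_radical X -> (0 < n)%N -> X (x ^+ n) -> X x.
Proof. by move=> rX n0 Xx; rewrite -rX; exists n. Qed.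

(** For [n = 0] the hypothesis says that [s] itself is a multiple of [a]. *)
Lemma radical_mults_exp a s x n : is_radical (mults a) ->
  mults a (s * x ^+ n) -> mults a (s * x).
Proof.
move=> ra as_; apply: (is_radicalP (n := n.+1)) => //.
by rewrite expgMc expgS [x ^+ _]expgSr mulgACA; apply: multsM.
Qed.

End Divisibility.

(** * Ideals, primes and local radicals *)

Section Ideals.
Local Open Scope group_scope.
Variables (H : cancMonoidType) (r : finitary_ideal_system H).
Implicit Types (a b c d e g h s t x y z : H) (X Y I J P Q L M S : set H).

Lemma r_idealM I x y : r_ideal r I -> I x -> I (x * y).
Proof. by move=> rI Ix; rewrite -rI; apply: closure_ext; left; exists x => //;
  exists y. Qed.

Lemma r_ideal_zeros I : r_ideal r I -> zeros H `<=` I.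
Proof. by move=> rI z zz; rewrite -rI; apply: closure_ext; right. Qed.

Lemma r_ideal_sub I X : r_ideal r I -> X `<=` I -> r X `<=` I.
Proof. by move=> rI XI; rewrite -rI; apply: closure_mono. Qed.

Lemma r_ideal_mults_sub I a : r_ideal r I -> I a -> mults a `<=` I.
Proof. by move=> rI Ia _ [h _ <-]; apply: r_idealM. Qed.

Lemma proper1 I : r_ideal r I -> proper_set I <-> ~ I 1.
Proof.
move=> rI; split=> [pI I1|I1 IT]; last by apply: I1; rewrite IT.
by apply: pI; apply/seteqP; split=> // x _; rewrite -(mul1g x); apply: r_idealM.
Qed.

Lemma closure1 a : r [set a] = mults a.
Proof.
apply/seteqP; split.
  rewrite (_ : [set a] = mul a @` [set 1]); last by rewrite image_set1 mulg1.
  by rewrite -closureZ => _ [h _ <-]; exact: mults_mul.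
move=> _ [h _ <-]; apply: closure_ext; left; exists a => //; by exists h.
Qed.

Lemma r_ideal_mults a : r_ideal r (mults a).
Proof. by rewrite -closure1; exact: r_ideal_closure. Qed.

Lemma closure_mulz c X x : r X x -> r (mul c @` X) (c * x).
Proof. by move=> rx; rewrite -closureZ; exists x. Qed.

Lemma closure_mul X Y x y : r X x -> r Y y -> r (mulset X Y) (x * y).
Proof.
by move=> rx ry; rewrite -closure_mulr -closure_mull; apply: sub_closure;
  exists x => //; exists y.
Qed.

Lemma closure_seq X x : r X x ->
  exists2 s : seq H, [set` s] `<=` X & r [set` s] x.
Proof.
rewrite closure_finitary => -[E [EX /finite_seqP[s e]] rx].
by exists s; rewrite -e.
Qed.

(** The finitary axiom in the form that applies to directed unions and to
    contractions of localizations. *)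
Lemma r_ideal_directed X :
  (forall s : seq H, [set` s] `<=` X ->
     exists Y, [/\ r_ideal r Y, [set` s] `<=` Y & Y `<=` X]) -> r_ideal r X.
Proof.
move=> dir; apply/seteqP; split; last exact: sub_closure.
move=> x /closure_seq[s /dir[Y [rY sY YX]] rx]; apply: YX.
exact: r_ideal_sub sY _ rx.
Qed.

(** Multiplying by [x * x] fixes [zeros H], so a nonzero [x] in [r (zeros H)] is
    a multiple of its own square; it is then a unit, and lies in [I]. *)
Lemma closure_zeros I : r_ideal r I -> ~ I 1 -> r (zeros H) `<=` zeros H.
Proof.
move=> rI I1 x rx; apply: contrapT => nx; apply: I1.
have e : mul (x * x) @` zeros H = zeros H.
  apply/seteqP; split=> [_ [z zz <-]|z zz]; first exact: zerosMr.
  by exists z => //; rewrite mulgC zz.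
move: (rx); rewrite -e -closureZ => -[y ry exy].
suff -> : 1 = y * x by apply: r_idealM => //;
  apply: (r_ideal_sub rI (r_ideal_zeros rI)).
by apply: (nonzero_mulgI nx); rewrite mulg1 -{1}exy /= -mulgA (mulgC x y).
Qed.

Definition colon I x : set H := [set y | I (y * x)].

Lemma r_ideal_colon I x : r_ideal r I -> r_ideal r (colon I x).
Proof.
move=> rI; apply/seteqP; split; last exact: sub_closure.
move=> y ry; rewrite /colon /= mulgC;
  apply: (r_ideal_sub (X := mul x @` colon I x) rI).
  by move=> _ [z Iz <-]; rewrite mulgC.
exact: closure_mulz.
Qed.

Definition mul_closed S := forall x y, S x -> S y -> S (x * y).

Lemma max_avoiding S I : r_ideal r I -> I `&` S = set0 ->
  exists M, [/\ r_ideal r M, I `<=` M, M `&` S = set0 &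
    forall Y, r_ideal r Y -> M `<=` Y -> Y `&` S = set0 -> Y = M].
Proof.
move=> rI IS.
(* With [I] kept apart from [X] the empty chain has the upper bound [set0]. *)
pose Pr X := r (I `|` X) `&` S = set0.
have [F FP Ftot|X [PX Xmax]] := @Zorn_bigcup H Pr.
  rewrite /Pr -subset0 => x [rx Sx].
  have [s sX rsx] := closure_seq rx.
  have [F0|[X0 FX0]] : (forall X, ~ F X) \/ exists X, F X.
    by have [?|/asboolPn/existsp_asboolPn[X /contrapT FX]] :=
      pselect (forall X, ~ F X);
      [left|right; exists X].
    have rIx : r I x.
      by apply: (closure_mono _ rx) => y [//|[X /F0]].
    by rewrite -IS; split=> //; rewrite -rI.
  have [X FX sIX] : exists2 X, F X & [set` s] `<=` I `|` X.
    elim: s sX {rsx} => [|y s IHs] sX; first by exists X0.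
    have [|X FX sIX] := IHs.
      by move=> z zs; apply: sX; rewrite /= inE zs orbT.
    have [Iy|[X' FX' X'y]] : (I `|` \bigcup_(X in F) X) y.
    - by apply: sX; rewrite /= inE eqxx.
    - by exists X => // z /=; rewrite inE => /orP[/eqP->|/sIX//]; left.
    - have [XX'|X'X] := Ftot _ _ FX FX'.
        exists X' => // z /=; rewrite inE => /orP[/eqP->|/sIX[]];
          [by right|by left|].
        by move=> /XX'; right.
      exists X => // z /=; rewrite inE => /orP[/eqP->|/sIX//]; by right;
        apply: X'X.
  by rewrite -(FP _ FX); split=> //; apply: closure_mono rsx.
exists (r (I `|` X)); split => //.
- exact: r_ideal_closure.
- by move=> x Ix; apply: sub_closure; left.
- move=> Y rY XY YS; apply/seteqP; split=> // y Yy; apply: sub_closure; right.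
  apply: contrapT => Xy; have [] := Xmax Y.
    split=> [x Xx|YX]; first by apply: XY; apply: sub_closure; right.
    exact/Xy/YX.
  rewrite /Pr -YS; congr (_ `&` _); apply/seteqP; split; last first.
    by move=> x Yx; apply: sub_closure; right.
  apply: r_ideal_sub => // x [Ix|//]; apply: XY.
  by apply: sub_closure; left.
Qed.

(** Krull's argument: if neither [x] nor [y] is in [M], then enlarging [M] by
    either of them reaches an element of [S], and the product of these two
    elements is in [M] as soon as [x * y] is. *)
Lemma prime_of_max_avoiding S M : mul_closed S -> S 1 ->
  r_ideal r M -> M `&` S = set0 ->
  (forall Y, r_ideal r Y -> M `<=` Y -> Y `&` S = set0 -> Y = M) ->
  prime_r_ideal r M.
Proof.
move=> SM S1 rM MS Mmax.
have M1 : ~ M 1 by move=> M1; have : (M `&` S) 1 by []; rewrite MS.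
split=> //; split=> [||x y Mxy]; first 2 last.
- apply: contrapT => /not_orP[nx ny].
  have hit z : ~ M z -> exists2 s, S s & r (M `|` [set z]) s.
    move=> nz; apply: contrapT => nex; apply: nz.
    rewrite -(Mmax (r (M `|` [set z]))); first by apply: sub_closure; right.
    - exact: r_ideal_closure.
    - by move=> t Mt; apply: sub_closure; left.
    - by rewrite -subset0 => t [rt St]; apply: nex; exists t.
  have [s Ss rs] := hit _ nx; have [t St rt] := hit _ ny.
  have : (M `&` S) (s * t); last by rewrite MS.
  split; last exact: SM.
  apply: (r_ideal_sub rM _ (closure_mul rs rt)) => _ [u Mu] [v Mv] <-.
  case: Mu Mv => [Mu _|->]; first exact: r_idealM.
  by case=> [Mv|->//]; rewrite mulgC; exact: r_idealM.
- apply/seteqP; split=> [x Mx|x [[y My [z _ <-]]|zx]].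
  + by left; exists x => //; exists 1 => //; rewrite mulg1.
  + exact: r_idealM.
  + exact: r_ideal_zeros zx.
- exact/(proper1 rM).
Qed.

Lemma prime_avoiding S I : mul_closed S -> S 1 -> r_ideal r I ->
  I `&` S = set0 ->
  exists P, [/\ prime_r_ideal r P, I `<=` P & P `&` S = set0].
Proof.
move=> SM S1 rI IS; have [M [rM IM MS Mmax]] := max_avoiding rI IS.
by exists M; split=> //; exact: prime_of_max_avoiding Mmax.
Qed.

Lemma prime_r1 P : prime_r_ideal r P -> ~ P 1.
Proof. by move=> [rP [_ /(proper1 rP)]]. Qed.

Lemma prime_rM P x y : prime_r_ideal r P -> P (x * y) -> P x \/ P y.
Proof. by move=> [_ [_ _]]; apply. Qed.

Lemma prime_rMn P x y : prime_r_ideal r P -> ~ P x -> ~ P y -> ~ P (x * y).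
Proof. by move=> pP nx ny /(prime_rM pP)[]. Qed.

Lemma prime_s1 P : prime_s_ideal P -> ~ P 1.
Proof.
move=> [sP pP _] P1; apply: pP; apply/seteqP; split=> // x _.
by rewrite sP; left; exists 1 => //; exists x => //; rewrite mul1g.
Qed.

Lemma prime_sM P x y : prime_s_ideal P -> P x -> P (x * y).
Proof. by move=> [sP _ _] Px; rewrite sP; left; exists x => //; exists y. Qed.

Lemma prime_s_zeros P : prime_s_ideal P -> zeros H `<=` P.
Proof. by move=> [sP _ _] z zz; rewrite sP; right. Qed.

Lemma prime_sX P x n : prime_s_ideal P -> P (x ^+ n) -> P x.
Proof.
move=> pP; elim: n => [|n IHn]; first by move/(prime_s1 pP).
by case: (pP) => _ _ Pp; rewrite expgS => /Pp[].
Qed.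

Lemma prime_radical P : prime_s_ideal P -> is_radical P.
Proof.
move=> pP; apply/seteqP; split; last exact: sub_radical.
by move=> x [n _]; exact: prime_sX.
Qed.

Lemma radical_sub_prime P X : prime_s_ideal P -> X `<=` P -> radical X `<=` P.
Proof. by move=> /prime_radical {2}<-; exact: radical_mono. Qed.

Lemma r_max_max M : r_max r M ->
  [/\ r_ideal r M, ~ M 1 & forall Y, r_ideal r Y -> M `<=` Y -> ~ Y 1 -> Y = M].
Proof.
move=> [[rM pM] Mmax]; split=> //; first exact/(proper1 rM).
by move=> Y rY MY Y1; apply: Mmax => //; split=> //; exact/(proper1 rY).
Qed.

Lemma setI1 X : ~ X 1 -> X `&` [set 1] = set0.
Proof. by move=> X1; rewrite -subset0 => x [Xx x1]; apply: X1; rewrite -x1. Qed.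

Lemma r_max_prime M : r_max r M -> prime_r_ideal r M.
Proof.
move=> /r_max_max[rM M1 Mmax]; apply: (@prime_of_max_avoiding [set 1]) => //.
- by move=> x y -> ->; rewrite mulg1.
- exact: setI1.
- move=> Y rY MY Y1; apply: Mmax => // Y1'.
  by have : (Y `&` [set 1]) 1 by []; rewrite Y1.
Qed.

Lemma r_max_exists I : r_ideal r I -> ~ I 1 -> exists2 M, r_max r M & I `<=` M.
Proof.
move=> rI I1; have [M [rM IM M1 Mmax]] := max_avoiding rI (setI1 I1).
have nM1 : ~ M 1 by move=> ?; have : (M `&` [set 1]) 1 by []; rewrite M1.
exists M => //; split; first by split=> //; exact/(proper1 rM).
by move=> Y [rY /(proper1 rY) Y1] MY; apply: Mmax => //; exact: setI1.
Qed.

Lemma radical_primes I x : r_ideal r I ->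
  (forall P, prime_r_ideal r P -> I `<=` P -> P x) -> radical I x.
Proof.
move=> rI IP; apply: contrapT => nx.
have [|||P [pP PI PS]] := @prime_avoiding [set x ^+ n | n in setT] I _ _ rI.
- by move=> _ _ [n _ <-] [m _ <-]; exists (n + m)%N => //; rewrite expgnDr.
- by exists 0%N.
- rewrite -subset0 => y [Iy [n _ e]]; apply: nx; exists n.+1 => //.
  by rewrite expgSr; apply: r_idealM; rewrite // e.
- suff : (P `&` [set x ^+ n | n in setT]) x by rewrite PS.
  by split; [exact: IP|exists 1%N].
Qed.

(** The radical is the intersection of the prime [r]-ideals above [I]. *)
Lemma r_ideal_radical I : r_ideal r I -> r_ideal r (radical I).
Proof.
move=> rI; apply/seteqP; split; last exact: sub_closure.
move=> x rx; apply: radical_primes => // P pP IP; apply: r_ideal_sub rx;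
  first by case: pP.
by apply: radical_sub_prime => //; case: pP.
Qed.

(** Otherwise some prime [r]-ideal containing [y] would avoid all the products
    [s * x ^+ n] with [s] outside [L]; it would be contained in [L] and miss [x].
    This computes radicals in the localization at [L] without forming it. *)
Lemma local_radical L x y : prime_s_ideal L ->
  (forall P, prime_r_ideal r P -> P `<=` L -> P y -> P x) ->
  exists s n, ~ L s /\ mults y (s * x ^+ n).
Proof.
move=> pL Lx; apply: contrapT => nex.
pose S := [set s * x ^+ n | s in ~` L & n in setT].
have L1 := prime_s1 pL; have SM : mul_closed S.
  move=> _ _ [s Ls [n _ <-]] [t Lt [m _ <-]]; exists (s * t).
    by case: pL => _ _ Lp /Lp[].
  by exists (n + m)%N => //; rewrite expgnDr mulgACA.
have S1 : S 1 by exists 1 => //; exists 0%N => //; rewrite mulg1.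
have [|P [pP yP PS]] := prime_avoiding SM S1 (r_ideal_mults y).
  by rewrite -subset0 => z [yz [s Ls [n _ e]]]; apply: nex; exists s, n;
    rewrite e.
have nS z : P z -> ~ S z by move=> Pz Sz; have : (P `&` S) z by []; rewrite PS.
apply: (nS x); last by exists 1 => //; exists 1%N => //; rewrite mul1g.
apply: Lx => //; last exact/yP/mults_refl.
move=> z Pz; apply: contrapT => Lz; apply: (nS z) => //.
by exists z => //; exists 0%N => //; rewrite mulg1.
Qed.

Lemma local_radical_mults L x y : prime_s_ideal L -> is_radical (mults y) ->
  (forall P, prime_r_ideal r P -> P `<=` L -> P y -> P x) ->
  exists2 s, ~ L s & mults y (s * x).
Proof.
move=> pL ry /(local_radical pL)[s [n [Ls ys]]].
by exists s => //; exact: radical_mults_exp ys.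
Qed.

Lemma prime_r_below Q I : prime_s_ideal Q -> r_ideal r I -> I `<=` Q ->
  exists P, [/\ prime_r_ideal r P, I `<=` P & P `<=` Q].
Proof.
move=> pQ rI IQ; have [||| P [pP IP PQ]] := @prime_avoiding (~` Q) I _ _ rI.
- by case: pQ => _ _ Qp x y nx ny /Qp[].
- exact: prime_s1.
- by rewrite -subset0 => x [/IQ].
exists P; split=> // x Px; apply: contrapT => Qx.
by have : (P `&` ~` Q) x by []; rewrite PQ.
Qed.

(** The minimal prime is the complement of a maximal multiplicatively closed set
    that misses [I] and contains the complement of [Q]. *)
Lemma minimal_prime_below Q I : prime_s_ideal Q -> r_ideal r I -> I `<=` Q ->
  exists P, [/\ prime_r_ideal r P, minimal_primes I P & P `<=` Q].
Proof.
move=> pQ rI IQ.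
pose Pr X := mul_closed (X `|` ~` Q) /\ I `&` (X `|` ~` Q) = set0.
have [F FP Ftot|X [[XM XI] Xmax]] := @Zorn_bigcup H Pr.
  split; last first.
    rewrite -subset0 => x [Ix [[X FX Xx]|]]; last by apply; apply: IQ.
    by have [_ <-] := FP _ FX; split=> //; left.
  have QM : mul_closed (~` Q) by case: pQ => _ _ Qp x y nx ny /Qp[].
  have FM X x y : F X -> (X `|` ~` Q) x -> (X `|` ~` Q) y ->
      (\bigcup_(X in F) X `|` ~` Q) (x * y).
    by move=> FX Xx Xy; have [XM _] := FP _ FX; case: (XM _ _ Xx Xy); [left;
      exists X|right].
  move=> x y [[X FX Xx]|nx] [[Y FY Yy]|ny].
  - have [XY|YX] := Ftot _ _ FX FY.
      by apply: (FM Y) => //; left => //; apply: XY.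
    by apply: (FM X) => //; left => //; apply: YX.
  - by apply: (FM X) => //; [left|right].
  - by apply: (FM Y) => //; [right|left].
  - by right; apply: QM.
have Q1 := prime_s1 pQ.
have [|P [pP IP PX]] := prime_avoiding XM _ rI XI; first by right.
have PXn x : P x -> ~ (X `|` ~` Q) x.
  by move=> Px Xx; have : (P `&` (X `|` ~` Q)) x by []; rewrite PX.
exists P; split=> //.
  split=> [|P' [pP' IP'] P'P]; first by split=> //; case: pP.
  apply/seteqP; split=> // x Px; apply: contrapT => nP'x.
  have XP' : X `<=` ~` P' by move=> y Xy /P'P/PXn; apply; left.
  have e : ~` P' `|` ~` Q = ~` P'.
    apply/setUidPl => y Qy P'y; apply: (PXn y); [exact: P'P|by right].
  apply: (Xmax (~` P')).
    split=> // /(_ x nP'x) Xx; apply: (PXn x) => //; by left.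
  rewrite /Pr e; split; last by rewrite -subset0 => y [/IP'].
  by case: pP' => _ _ P'p y z ny nz /P'p[].
by move=> x Px; apply: contrapT => Qx; apply: (PXn x) => //; right.
Qed.

End Ideals.

(** * Principal radicals and height one *)

Section PrincipalRadicals.
Local Open Scope group_scope.
Variables (H : cancMonoidType) (r : finitary_ideal_system H).
Implicit Types (a b c d e g h s t x y z : H) (X Y I J P Q L M S : set H).

Lemma r_ideal_s_ideal I : r_ideal r I -> s_ideal I.
Proof.
move=> rI; apply/seteqP; split=> [x Ix|x [[y Iy [z _ <-]]|zx]].
- by left; exists x => //; exists 1 => //; rewrite mulg1.
- exact: (r_idealM _ rI).
- exact: (r_ideal_zeros rI).
Qed.

Lemma primary_radical_prime I : primary_r_ideal r I ->
  prime_r_ideal r (radical I).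
Proof.
move=> [rI [_ /(proper1 rI) I1 Ip]]; have rR := r_ideal_radical rI.
split=> //; split; first exact: r_ideal_s_ideal.
  by apply/(proper1 rR) => -[n _]; rewrite expg1n.
move=> x y [n n0]; rewrite expgMc => Ixy.
have [Ix|nIx] := pselect (I (x ^+ n)); first by left; exists n.
right; have [m m0 Iy] := Ip _ _ Ixy nIx.
by exists (n * m)%N; rewrite ?muln_gt0 ?n0// expgnA.
Qed.

Lemma powsetS X k : powset X k.+1 = mulset X (powset X k).
Proof. by rewrite /powset /prodset /= big_cons. Qed.

Lemma powset0 X : powset X 0 = [set 1].
Proof. by rewrite /powset /prodset /= big_nil. Qed.

Lemma mulset1 X : mulset X [set 1] = X.
Proof.
apply/seteqP; split=> [_ [x Xx [_ -> <-]]|x Xx]; first by rewrite mulg1.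
by exists x => //; exists 1 => //; rewrite mulg1.
Qed.

Lemma powset1 X : powset X 1 = X.
Proof. by rewrite powsetS powset0 mulset1. Qed.

Lemma mulsetS X X' Y Y' : X `<=` X' -> Y `<=` Y' ->
  mulset X Y `<=` mulset X' Y'.
Proof. by move=> XX YY _ [x /XX Xx [y /YY Yy <-]]; exists x => //; exists y.
Qed.

Lemma powset_sub_sq L k : r (powset L k.+2) `<=` r (mulset L L).
Proof.
apply: r_ideal_sub; first exact: r_ideal_closure.
rewrite !powsetS mulsetA => _ [x Lx [y _ <-]].
by apply: (@r_idealM _ r); [exact: r_ideal_closure|exact: sub_closure].
Qed.

Lemma sq_sub_powset L k : r_ideal r L -> L `<=` r (mulset L L) ->
  L `<=` r (powset L k.+1).
Proof.
move=> rL LL; elim: k => [|k IHk]; first by rewrite powset1 rL.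
rewrite powsetS -closure_mulr => x /LL; apply: closure_mono.
exact: mulsetS.
Qed.

(** A primary ideal other than its radical [L] is a power of [L] with exponent at
    least two; and [L] is not idempotent, or else its powers would coincide. *)
Lemma inclusive_power P Q :
  r_prime_power_condition r -> primary_r_ideal_inclusive r ->
  prime_r_ideal r P -> prime_r_ideal r Q -> P `<` Q ->
  exists L, [/\ prime_r_ideal r L, L `<=` Q, P `<=` r (mulset L L)
              & ~ L `<=` r (mulset L L)].
Proof.
move=> pw inc pP pQ PQ; have [I [pI PI [IR RI] RQ]] := inc _ _ pP pQ PQ.
have pR := primary_radical_prime pI; have [rR _] := pR.
have [[|[|k]]// _ e] := pw _ pI.
  by case: RI; rewrite {2}e powset1 rR.
exists (radical I); split=> //.
  by move=> x /PI; rewrite {1}e; exact: powset_sub_sq.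
by move=> /(sq_sub_powset k.+1 rR); rewrite -e.
Qed.

Definition principal_radicals :=
  forall I : set H, principal I -> principal (radical I).

Lemma radical_generator a : principal_radicals -> ~ zeros H a ->
  exists d c, [/\ ~ zeros H d, radical (mults a) = mults d, a = d * c
               & is_radical (mults d)].
Proof.
move=> RP na; have ea : radical (mults a) a by apply/sub_radical/mults_refl.
have [|d nd e] := principal_nontrivial (RP _ (principal_mults a)).
  by apply/nontrivialP; [move=> z /(zeros_mults a)/sub_radical|exists a].
move: (ea); rewrite e => /multsP[c ec]; exists d, c; split=> //.
by rewrite -e; exact: radical_idem.
Qed.

(** Since [y H] is radical, [L] is generated by [y] locally at [L].  For [q] in a
    smaller prime [P] write [s * q = y * h] with [s] outside [L]; every prime of
    [L] containing [q] contains [h], so if [q H] is radical then [h] is locally a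
    multiple of [q], and cancelling [q] makes [y] a local unit. *)
Lemma minimal_over_radical L P y q :
  prime_r_ideal r L -> is_radical (mults y) -> L y ->
  (forall P', prime_r_ideal r P' -> P' `<=` L -> P' y -> P' = L) ->
  prime_r_ideal r P -> P `<=` L -> P q -> ~ zeros H q -> is_radical (mults q) ->
  P = L.
Proof.
move=> pL ry Ly Lmin pP PL Pq nq rq; apply: contrapT => PneL.
have nPy : ~ P y by move=> Py; apply/PneL/Lmin.
have rL : r_ideal r L by case: pL.
have [|s Ls /multsP[h e]] := local_radical_mults (r := r) (x := q) pL.2 ry.
  by move=> P' pP' P'L P'y; rewrite (Lmin P')//; exact: PL.
have Ph : P h.
  have : P (y * h) by rewrite -e mulgC; apply: (r_idealM _ pP.1).
  by move=> /(prime_rM pP)[].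
have [|t Lt /multsP[g f]] := local_radical_mults (r := r) (x := h) pL.2 rq.
  move=> P' pP' P'L P'q.
  have : P' (y * h) by rewrite -e mulgC; apply: (r_idealM _ pP'.1).
  by move=> /(prime_rM pP')[P'y|//]; rewrite (Lmin P')//; exact: PL.
apply: (prime_rMn pL Ls Lt); suff -> : s * t = y * g by exact: (r_idealM _ rL).
apply: (nonzero_mulgI nq); rewrite [RHS]mulgCA -f [RHS]mulgCA -e.
by rewrite [LHS]mulgCA [RHS]mulgCA (mulgC q).
Qed.

Lemma minimal_over_generator L a y : radical (mults a) = mults y ->
  prime_r_ideal r L ->
  (forall P', prime_r_ideal r P' -> P' `<=` L -> P' a -> P' = L) ->
  (forall P', prime_r_ideal r P' -> P' `<=` L -> P' y -> P' = L).
Proof.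
move=> e pL Lmin P' pP' P'L P'y; apply: Lmin => //.
have : mults y a by rewrite -e; apply/sub_radical/mults_refl.
by move=> [h _ <-]; apply: (r_idealM _ pP'.1).
Qed.

Lemma generator_in_prime P a y : radical (mults a) = mults y ->
  prime_r_ideal r P -> P a -> P y.
Proof.
move=> e [rP pP] Pa; apply: (radical_sub_prime pP (r_ideal_mults_sub rP Pa)).
by rewrite e; exact: mults_refl.
Qed.

(** There are no two nontrivial primes [P] and [M] with [P] strictly inside [M].
    Otherwise let [L] be a non-idempotent prime between them, as provided by
    [inclusive_power], and [y] the radical of some [x] in [L] outside the square
    of [L]; then [y] is also outside that square.  A prime containing [y] strictly
    inside [L] would be contained in the square of another prime inside [L], so
    [L] is minimal over [y] and [minimal_over_radical] rules out [P]. *)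
Lemma prime_power_treed : r_prime_power_condition r ->
  primary_r_ideal_inclusive r -> principal_radicals -> r_treed r.
Proof.
move=> pw inc RP M /r_max_prime pM.
suff triv P : prime_r_ideal r P -> P `<=` M -> nontrivial P -> P = M.
  move=> P Q pP pQ PM QM; have zP := r_ideal_zeros pP.1;
    have zQ := r_ideal_zeros pQ.1.
  have [/triv->//|/(trivialP zP)->] := pselect (nontrivial P); first by right.
  by left.
move=> pP PM ntP; apply: contrapT => PneM.
have PltM : P `<` M by split=> // MP; apply/PneM/seteqP.
have [L [pL LM PL2 nL]] := inclusive_power pw inc pP pM PltM.
have rL2 : r_ideal r (r (mulset L L)) by exact: r_ideal_closure.
have L2L : r (mulset L L) `<=` L.
  by apply: (r_ideal_sub pL.1); move=> _ [x Lx [y _ <-]];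
    apply: (r_idealM _ pL.1).
have [x Lx nx] : exists2 x, L x & ~ r (mulset L L) x.
  by apply: contrapT => nex; apply: nL => x Lx; apply: contrapT => nx;
    apply: nex; exists x.
have nzx : ~ zeros H x by move=> zx; apply/nx/(r_ideal_zeros rL2).
have [y [c [nzy ey exy ry]]] := radical_generator RP nzx.
have nL2y : ~ r (mulset L L) y by move=> Ly; apply: nx; rewrite exy;
  exact: (r_idealM _ rL2).
have Ly := generator_in_prime ey pL Lx.
have [p Pp np] := (nontrivialP (r_ideal_zeros pP.1)).1 ntP.
have [q [c' [nzq eq epq rq]]] := radical_generator RP np.
have Pq := generator_in_prime eq pP Pp.
suff PL : P = L by apply: nL; rewrite -{1}PL.
apply: (@minimal_over_radical L P y q) => //; last by move=> z /PL2/L2L.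
move=> P' pP' P'L P'y; apply: contrapT => P'neL.
have P'ltL : P' `<` L by split=> // LP'; apply/P'neL/seteqP.
have [L' [_ L'L P'L2 _]] := inclusive_power pw inc pP' pL P'ltL.
by apply: nL2y; move/P'L2: P'y; apply: closure_mono; exact: mulsetS.
Qed.

Lemma minimal_primes_r_ideal I P : r_ideal r I -> minimal_primes I P ->
  prime_r_ideal r P /\
  forall P', prime_r_ideal r P' -> I `<=` P' -> P' `<=` P -> P' = P.
Proof.
move=> rI [[pP IP] Pmin]; have [P' [pP' IP' P'P]] := prime_r_below pP rI IP.
split; first by rewrite -(Pmin P')//; split=> //; case: pP'.
by move=> Q [rQ pQ] IQ QP; apply: Pmin.
Qed.

(** In a tree the primes witnessing that [P] is not minimal over the members of
    a finite set form a chain, whose largest member witnesses that [P] is not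
    minimal over the whole set. *)
Lemma treed_minimal_over M P (E : seq H) : r_treed r -> r_max r M ->
  prime_r_ideal r P -> P `<=` M ->
  (forall a, a \in E -> ~ zeros H a ->
    exists2 P', prime_r_ideal r P' /\ P' a & P' `<` P) ->
  [set` E] `<=` zeros H \/
  exists2 P', prime_r_ideal r P' /\ [set` E] `<=` P' & P' `<` P.
Proof.
move=> tr mM pP PM; elim: E => [|a E IHE] wit; first by left=> x.
have {}IHE : [set` E] `<=` zeros H \/
  exists2 P', prime_r_ideal r P' /\ [set` E] `<=` P' & P' `<` P.
  by apply: IHE => x xE; apply: wit; rewrite inE xE orbT.
have [za|na] := pselect (zeros H a).
  case: IHE => [zE|[P' [pP' EP'] P'P]]; [left|right; exists P' => //;
    split=> //].
    by move=> x /=; rewrite inE => /orP[/eqP->|/zE].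
  move=> x /=; rewrite inE => /orP[/eqP->|/EP'//].
  by apply: (r_ideal_zeros pP'.1).
have [P' [pP' P'a] P'P] : exists2 P', prime_r_ideal r P' /\ P' a & P' `<` P.
  by apply: wit; rewrite ?inE ?eqxx.
right; case: IHE => [zE|[Q [pQ EQ] QP]].
  exists P' => //; split=> // x /=; rewrite inE => /orP[/eqP->//|/zE].
  exact: (r_ideal_zeros pP'.1).
have [P'Q|QP'] : P' `<=` Q \/ Q `<=` P'.
  by apply: (tr M) => // x; [move/(properW P'P)/PM|move/(properW QP)/PM].
  exists Q => //; split=> // x /=; rewrite inE => /orP[/eqP->|/EQ//].
  exact: P'Q.
by exists P' => //; split=> // x /=; rewrite inE => /orP[/eqP->|/EQ/QP'].
Qed.

(** A prime minimal over a finitely generated ideal is minimal over one of the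
    generators [a], hence over the generator of the radical of [a H], and
    [minimal_over_radical] shows that it has height one. *)
Lemma treed_minimal_primes I : r_treed r -> principal_radicals ->
  r_ideal r I -> nontrivial I -> r_finitely_generated r I ->
  minimal_primes I `<=` height_one_primes H.
Proof.
move=> tr RP rI ntI [_ [/finite_seqP[E ->] EI eI]] P mP.
have [pP Pmin] := minimal_primes_r_ideal rI mP; have [[sP IP] _] := mP.
have [M mM PM] := r_max_exists pP.1 (prime_r1 pP).
have zI := r_ideal_zeros rI.
have [a aE [na Pamin]] : exists2 a, a \in E & ~ zeros H a /\
   forall P', prime_r_ideal r P' -> P' `<=` P -> P' a -> P' = P.
  apply: contrapT => nex.
  have [a aE na|Ez|[P' [pP' EP'] [P'P]]] :=
    @treed_minimal_over M P E tr mM pP PM.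
  - apply: contrapT => nw; apply: nex; exists a => //; split=> //.
    move=> P' pP' P'P P'a; apply: contrapT => ne; apply: nw; exists P' => //.
    by split=> // PP'; apply/ne/seteqP.
  - case: ntI => _; apply; rewrite eI => x /(closure_mono Ez).
    exact: (closure_zeros pP.1 (prime_r1 pP)).
  - by apply; rewrite (Pmin P')// eI; apply: (r_ideal_sub pP'.1).
have [y [c [nzy ey _ ry]]] := radical_generator RP na.
have Pa : P a by apply: IP; rewrite eI; apply: sub_closure.
split=> [|Q [pQ ntQ] QP].
  split=> //; apply/nontrivialP; first exact: r_ideal_zeros pP.1.
  by exists a.
have [b Qb nb] := (nontrivialP (prime_s_zeros pQ)).1 ntQ.
have [q [g [nzq eq _ rq]]] := radical_generator RP nb.
have bQ : mults b `<=` Q by move=> _ [h _ <-]; exact: prime_sM.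
have qQ : mults q `<=` Q by rewrite -eq; exact: radical_sub_prime.
have [P1 [pP1 qP1 P1Q]] := prime_r_below pQ (r_ideal_mults r q) qQ.
have e : P1 = P.
  apply: (minimal_over_radical pP ry _ _ pP1 _ (qP1 _ (mults_refl q)) nzq rq).
  - exact: generator_in_prime ey pP Pa.
  - exact: minimal_over_generator ey pP Pamin.
  - by move=> x /P1Q/QP.
by apply/seteqP; split=> //; rewrite -e.
Qed.

(** For radical [x] and [y], the radical [z] of [x * y] is their least common
    multiple, and [d = x * y / z] generates the same radical as [x] and [y]: in
    a minimal prime of both, which has height one, [x] is locally a multiple
    of [z], so that [y] would miss that prime if [d] did. *)
Lemma radical_pair_principal x y :
  (forall I, r_ideal r I -> nontrivial I -> r_finitely_generated r I ->
     minimal_primes I `<=` height_one_primes H) ->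
  principal_radicals -> ~ zeros H x -> ~ zeros H y ->
  is_radical (mults x) -> is_radical (mults y) ->
  principal (radical (r [set` [:: x; y]])).
Proof.
move=> min1 RP nx ny rx ry; set I := r _.
have Ixy : I x /\ I y by split; apply: sub_closure; rewrite /= !inE eqxx ?orbT.
have rI : r_ideal r I by exact: r_ideal_closure.
have [z [d [nzz ez exy rz]]] := radical_generator RP (nzM nx ny).
have zz : radical (mults (x * y)) z by rewrite ez; exact: mults_refl.
have /multsP[x' zx] : mults x z.
  by rewrite -rx; apply: radical_mono zz; apply: mults_sub; exact: mults_mul.
have /multsP[y' zy] : mults y z.
  rewrite -ry; apply: radical_mono zz; apply: mults_sub; rewrite mulgC.
  exact: mults_mul.
have ex : x = d * y'.
  apply: (nonzero_mulgI ny); rewrite mulgC exy zy.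
  by rewrite -mulgA (mulgC y').
have ey : y = d * x'.
  by apply: (nonzero_mulgI nx); rewrite exy zx -mulgA (mulgC x').
suff -> : radical I = radical (mults d) by exact/RP/principal_mults.
apply/seteqP; split.
  apply: radical_mono; apply: r_ideal_sub; first exact: (r_ideal_mults r).
  by move=> t /=; rewrite !inE => /orP[]/eqP->; [rewrite ex|rewrite ey];
    exact: mults_mul.
rewrite -(radical_idem I); apply: radical_mono;
  apply: (r_ideal_mults_sub (r_ideal_radical rI)).
apply: (radical_primes rI) => P [_ pP] IP.
have [P0 [pP0 mP0 P0P]] := minimal_prime_below pP rI IP.
apply: P0P; apply: contrapT => nP0d.
have IP0 : I `<=` P0 by case: (mP0) => -[].
have [P0x P0y] : P0 x /\ P0 y by split; apply: IP0; case: Ixy.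
have P0z : P0 z.
  by apply: (generator_in_prime ez pP0); apply: (r_idealM _ pP0.1).
have [[_ _] h1] : height_one_primes H P0.
  apply: (min1 I) => //.
    by apply/(nontrivialP (r_ideal_zeros rI)); exists x => //; case: Ixy.
  exists [set` [:: x; y]]; split=> //; exact: sub_closure.
have [|t P0t /multsP[g e]] := local_radical_mults (r := r) (x := x) pP0.2 rz.
  move=> P' [rP' pP'] P'P0 P'z; rewrite (h1 P')//; split=> //.
  by apply/(nontrivialP (r_ideal_zeros rP')); exists z.
apply: (prime_rMn pP0 P0t nP0d);
  suff -> : t * d = y * g by apply: (r_idealM _ pP0.1).
apply: (nonzero_mulgI nzz); rewrite mulgCA -exy mulgA e.
by rewrite -mulgA (mulgC g).
Qed.

Lemma radical_closureU X Y :
  radical (r (X `|` Y)) = radical (r (radical (r X) `|` radical (r Y))).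
Proof.
apply/seteqP; split.
  apply: radical_mono; apply: closure_mono => x [Xx|Yx]; [left|right];
    exact/sub_radical/sub_closure.
rewrite -[X in _ `<=` X](@radical_idem H); apply: radical_mono.
apply: r_ideal_sub; first exact/r_ideal_radical/r_ideal_closure.
by move=> x [|]; apply: radical_mono; apply: closure_mono => y; [left|right].
Qed.

(** By induction on the number of generators: a generator, and the ideal generated
    by the others, may each be replaced by the generator of its radical. *)
Lemma height_one_radicals_principal :
  (forall I, r_ideal r I -> nontrivial I -> r_finitely_generated r I ->
     minimal_primes I `<=` height_one_primes H) ->
  principal_radicals ->
  forall I, r_ideal r I -> r_finitely_generated r I -> principal (radical I).
Proof.
move=> min1 RP I _ [_ [/finite_seqP[E ->] _ ->]]; elim: E => [|a E IHE].
  have r0 : r_ideal r (r [set` [::]]) by exact: r_ideal_closure.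
  have [r1|nr1] := pselect (r (zeros H) 1).
    have -> : r [set` [::]] = mults 1; last exact/RP/principal_mults.
    apply/seteqP; split=> // [x _|x _]; first exact: mults1.
    rewrite -(mul1g x); apply: (r_idealM _ r0) => //.
    exact: (r_ideal_sub r0 (r_ideal_zeros r0) r1).
  have -> : r [set` [::]] = zeros H; last exact/RP/principal_zeros.
  apply/seteqP; split; last exact: (r_ideal_zeros r0).
  move=> x rx; apply: (closure_zeros (r_ideal_closure r (zeros H)) nr1).
  by apply: (closure_mono _ rx) => y.
have -> : [set` a :: E] = [set a] `|` [set` E].
  by apply/seteqP; split=> [x /=|x [->|xE]] /=; rewrite inE;
    [move/orP=> [/eqP|]; [left|right]|rewrite eqxx|rewrite xE orbT].
rewrite radical_closureU closure1.
have rR : r_ideal r (radical (r [set` E])) by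
  exact/r_ideal_radical/r_ideal_closure.
have zeroU X : r_ideal r X -> is_radical X -> principal X ->
  principal (radical (r (zeros H `|` X))).
  move=> rX radX pX; rewrite (_ : _ `|` _ = X) ?rX ?radX//.
  by apply/setUidPr; exact: (r_ideal_zeros rX).
have ra : r_ideal r (radical (mults a)) by exact/r_ideal_radical/r_ideal_mults.
have pa : principal (radical (mults a)) by exact/RP/principal_mults.
have [nta|/(trivialP (r_ideal_zeros ra))->] :=
  pselect (nontrivial (radical (mults a))); last first.
  by apply: zeroU => //; exact: radical_idem.
have [ntE|/(trivialP (r_ideal_zeros rR))->] :=
  pselect (nontrivial (radical (r [set` E]))); last first.
  by rewrite setUC; apply: zeroU => //; exact: radical_idem.
have [x nx ex] := principal_nontrivial pa nta.
have [y ny ey] := principal_nontrivial IHE ntE.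
suff -> : r (radical (mults a) `|` radical (r [set` E])) = r [set` [:: x; y]].
  apply: radical_pair_principal => //; first by rewrite -ex;
    exact: radical_idem.
  by rewrite -ey; exact: radical_idem.
have rxy : r_ideal r (r [set` [:: x; y]]) by exact: r_ideal_closure.
rewrite ex ey; apply/seteqP; split.
  have [Ex Ey] : r [set` [:: x; y]] x /\ r [set` [:: x; y]] y.
    by split; apply: sub_closure; rewrite /= !inE eqxx ?orbT.
  by apply: r_ideal_sub => // t [xt|yt];
    [apply: (r_ideal_mults_sub rxy Ex)|apply: (r_ideal_mults_sub rxy Ey)].
apply: closure_mono => t /=; rewrite !inE => /orP[]/eqP->; [left|right];
  exact: mults_refl.
Qed.

End PrincipalRadicals.

(** * Principal radicals of finitely generated ideals *)

Section DimensionOne.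
Local Open Scope group_scope.
Variables (H : cancMonoidType) (r : finitary_ideal_system H).
Implicit Types (a b c d e g h s t u v w x y z : H) (X Y I J P Q L M S : set H).

(** The prime [M] has height at most one among the prime [r]-ideals. *)
Definition no_prime_below M :=
  forall P, prime_r_ideal r P -> P `<=` M -> nontrivial P -> P = M.

Lemma prime_nontrivial P x : prime_r_ideal r P -> P x -> ~ zeros H x ->
  nontrivial P.
Proof. by move=> pP Px nx; apply/(nontrivialP (r_ideal_zeros pP.1)); exists x.
Qed.

Lemma uniformizer_divides M b x : prime_r_ideal r M -> no_prime_below M ->
  ~ zeros H b -> is_radical (mults b) -> M x ->
  exists2 s, ~ M s & mults b (s * x).
Proof.
move=> pM hM nb rb Mx;
  apply: (local_radical_mults (r := r) pM.2 rb) => P pP PM Pb.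
by rewrite (hM P)//; exact: prime_nontrivial Pb nb.
Qed.

Lemma divides_uniformizer_power M b a : prime_r_ideal r M -> no_prime_below M ->
  M b -> ~ zeros H a -> exists s n, ~ M s /\ mults a (s * b ^+ n).
Proof.
move=> pM hM Mb na; apply: (local_radical (r := r) pM.2) => P pP PM Pa.
by rewrite (hM P)//; exact: prime_nontrivial Pa na.
Qed.

(** The localization at [M] is a discrete valuation monoid with uniformizer [b]: in
    [s * b ^+ n = a * h] with [h] in [M] a factor [b] of both sides cancels. *)
Lemma associate_uniformizer_power M b a : prime_r_ideal r M ->
  no_prime_below M ->
  M b -> ~ zeros H b -> is_radical (mults b) -> ~ zeros H a ->
  exists s h n, [/\ ~ M s, ~ M h & s * b ^+ n = a * h].
Proof.
move=> pM hM Mb nb rb na.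
have [s [n [Ms /multsP[h e]]]] := divides_uniformizer_power pM hM Mb na.
elim: n s h Ms e => [|n IHn] s h Ms e; have [Mh|nMh] := pselect (M h).
- by case: Ms; move: e; rewrite expg0 mulg1 mulgC => ->;
    exact: (r_idealM _ pM.1).
- by exists s, h, 0%N.
- suff [t [g [Mt f]]] : exists t g, ~ M t /\ t * b ^+ n = a * g by exact: IHn f.
  have [t Mt /multsP[g f]] := uniformizer_divides pM hM nb rb Mh.
  exists (t * s), g; split; first exact: (prime_rMn pM).
  apply: (nonzero_mulgI nb); rewrite [RHS]mulgCA -f [RHS]mulgCA -e expgS.
  by rewrite [LHS]mulgCA -mulgA.
- by exists s, h, n.+1.
Qed.

Definition fg_radicals_principal :=
  forall I, r_ideal r I -> r_finitely_generated r I -> principal (radical I).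

Lemma r_fg_seq (E : seq H) : r_finitely_generated r (r [set` E]).
Proof. by exists [set` E]; split=> //; exact: sub_closure. Qed.

Lemma fg_principal_radicals : fg_radicals_principal -> principal_radicals H.
Proof.
move=> fg I /principalP[->|[a ->]].
  by rewrite radical_zeros; exact: principal_zeros.
apply: fg; first exact: r_ideal_mults.
exists [set a]; split=> //; last by rewrite closure1.
by move=> _ ->; exact: mults_refl.
Qed.

Lemma fg_radical_pair p q : fg_radicals_principal -> ~ zeros H p ->
  exists d, [/\ ~ zeros H d, radical (r [set` [:: p; q]]) = mults d,
    mults d p, mults d q
    & forall P, prime_r_ideal r P -> P p -> P q -> P d].
Proof.
move=> fg np; set I := r _.
have rI : r_ideal r I by exact: r_ideal_closure.
have [Ip Iq] : I p /\ I q by split; apply: sub_closure;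
  rewrite /= !inE eqxx ?orbT.
have [|d nd e] := principal_nontrivial (fg I rI (r_fg_seq _)).
  apply/(nontrivialP (r_ideal_zeros (r_ideal_radical rI))); exists p => //.
  exact: sub_radical.
exists d; split=> //; try by rewrite -e; exact: sub_radical.
move=> P [rP pP] Pp Pq; have : mults d d by exact: mults_refl.
rewrite -e; apply: (radical_sub_prime pP); apply: (r_ideal_sub rP) => t /=.
by rewrite !inE => /orP[]/eqP->.
Qed.

(** If [p H] is radical, with [p] in [P] and [q] in a larger prime [Q] outside
    [P], then [p = d * p'] with [d] the radical of [p] and [q], and the radical
    [e] of [d] and [p'] has its square dividing [p].  As [p H] is radical this
    makes [e] a unit, although both [d] and [p'] lie in [Q]. *)
Lemma fg_radicals_dim1 P Q : fg_radicals_principal ->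
  prime_r_ideal r P -> prime_r_ideal r Q -> P `<=` Q -> nontrivial P -> P = Q.
Proof.
move=> fg pP pQ PQ ntP; apply/seteqP; split=> // q Qq; apply: contrapT => nPq.
have [p0 Pp0 np0] := (nontrivialP (r_ideal_zeros pP.1)).1 ntP.
have [p [c [np e0 _ rp]]] := radical_generator (fg_principal_radicals fg) np0.
have Pp := generator_in_prime e0 pP Pp0.
have [d [nd _ /multsP[p' ep] dq Qd]] := fg_radical_pair q fg np.
have nPd : ~ P d by move=> Pd; apply/nPq/(r_ideal_mults_sub pP.1 Pd).
have Pp' : P p' by move: Pp; rewrite ep => /(prime_rM pP)[].
have [e [ne _ /multsP[d' ed] /multsP[p'' ep'] Qe]] := fg_radical_pair p' fg nd.
apply: (prime_r1 pQ); suff /multsP[g ->] : mults e 1.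
  by apply: (r_idealM _ pQ.1); apply: Qe => //; [apply: Qd => //;
    exact: PQ|exact: PQ].
have ep2 : p = (e * e) * (d' * p'') by rewrite ep ed ep' mulgACA.
have : mults p (e * (d' * p'')).
  apply: (is_radicalP (n := 2)) => //.
  by rewrite expg2 mulgACA mulgA -ep2; exact: mults_mul.
move=> /multsP[g eg]; exists g => //.
have nk : ~ zeros H (e * (d' * p'')) by apply: nzMr (e) _ _; rewrite mulgA -ep2.
by apply: (nonzero_mulgI nk); rewrite mulg1 [RHS]eg ep2 [LHS]mulgACA mulgA.
Qed.

(** [c] is a generator of [x H : radical (x H)], determined up to a unit. *)
Definition radical_quotient x c :=
  exists d, radical (mults x) = mults d /\ x = d * c.

Lemma radical_quotient_exists x : principal_radicals H -> ~ zeros H x ->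
  exists c, radical_quotient x c.
Proof.
by move=> RP nx; have [d [c [_ ed ex _]]] := radical_generator RP nx;
  exists c, d.
Qed.

(** If [y = x * z] and [d] generates the radical of [x H], then [d * z] is in the
    radical of [y H]. *)
Lemma radical_quotient_mono x y c e : ~ zeros H y -> mults x y ->
  radical_quotient x c -> radical_quotient y e -> mults c e.
Proof.
move=> ny /multsP[z exy] [d [rd ex]] [d' [rd' ey]].
have [n n0 dn] : radical (mults x) d by rewrite rd; exact: mults_refl.
have /multsP[g dz] : mults d' (d * z).
  rewrite -rd'; exists n => //; rewrite exy expgMc; apply: mults_mulM => //.
  by case: n n0 {dn} => // n _; rewrite expgS; exact: mults_mul.
have nd' : ~ zeros H d' by move: ny; rewrite ey; exact: nzMl.
suff -> : e = c * g by exact: mults_mul.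
by apply: (nonzero_mulgI nd'); rewrite -ey exy ex mulgAC dz mulgCA mulgC.
Qed.

Fixpoint radical_quotient_iter n x v : Prop :=
  if n is m.+1 then exists2 c, radical_quotient x c & radical_quotient_iter m
    c v
  else v = x.

Lemma radical_quotient_nz x c : ~ zeros H x -> radical_quotient x c ->
  ~ zeros H c.
Proof. by move=> nx [d [_ ex]]; move: nx; rewrite ex; exact: nzMr. Qed.

Lemma radical_quotient_dvd x c : radical_quotient x c -> mults c x.
Proof. by move=> [d [_ ->]]; rewrite mulgC; exact: mults_mul. Qed.

Lemma iter_exists n x : principal_radicals H -> ~ zeros H x ->
  exists v, radical_quotient_iter n x v.
Proof.
move=> RP; elim: n x => [|n IHn] x nx; first by exists x.
have [c qc] := radical_quotient_exists RP nx.
have [v cv] := IHn _ (radical_quotient_nz nx qc); exists v; by exists c.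
Qed.

Lemma iter_mono n x y u v : ~ zeros H y -> mults x y ->
  radical_quotient_iter n x u -> radical_quotient_iter n y v -> mults u v.
Proof.
elim: n x y => [|n IHn] x y ny xy /= ; first by move=> -> ->.
move=> [c qc cu] [e qe ev]; apply: IHn cu ev;
  first exact: radical_quotient_nz qe.
exact: radical_quotient_mono qc qe.
Qed.

Lemma iter_antimono n m x u v : principal_radicals H -> ~ zeros H x ->
  (n <= m)%N ->
  radical_quotient_iter n x u -> radical_quotient_iter m x v -> mults v u.
Proof.
move=> RP nx /subnKC <-; elim: (m - n)%N v => [|k IHk] v xu.
  by rewrite addn0 => xv; exact: (iter_mono nx (mults_refl x) xv xu).
have [w xw] := iter_exists (n + k) RP nx; have wu := IHk _ xu xw.
rewrite addnS => -[c qc cv]; apply: mults_trans wu.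
exact: (iter_mono nx (radical_quotient_dvd qc) cv xw).
Qed.

(** Otherwise the quotients of [a] by its successive radicals generate a proper
    [r]-ideal, so all lie in one maximal [M]; passing from one to the next
    divides by an element of [M], which is locally a multiple of a uniformizer
    [b], while [a] divides a power of [b] locally at [M]. *)
Lemma iter_reaches_unit a : fg_radicals_principal -> ~ zeros H a ->
  exists n v, radical_quotient_iter n a v /\ mults v 1.
Proof.
move=> fg na; apply: contrapT => nex; have RP := fg_principal_radicals fg.
pose U := [set w | exists n v, radical_quotient_iter n a v /\ mults v w].
have rU : r_ideal r U.
  apply: r_ideal_directed => s sU.
  suff [n [v [av sv]]] :
    exists n v, radical_quotient_iter n a v /\ [set` s] `<=` mults v.
    exists (mults v); split=> //; first exact: r_ideal_mults.
    by move=> w vw; exists n, v.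
  elim: s sU => [|x s IHs] sU; first by exists 0%N, a.
  have [|n [v [av sv]]] := IHs.
    by move=> y ys; apply: sU; rewrite /= inE; apply/orP; right.
  have [m [w [aw wx]]] : U x by apply: sU; rewrite /= inE eqxx.
  have [t at_] := iter_exists (maxn n m) RP na.
  exists (maxn n m), t; split=> // y /=; rewrite inE => /orP[/eqP->|/sv].
    by apply: mults_trans wx; apply: iter_antimono aw at_; rewrite // leq_maxr.
  by apply: mults_trans; apply: iter_antimono av at_; rewrite // leq_maxl.
have [M mM UM] : exists2 M, r_max r M & U `<=` M.
  by apply: r_max_exists => // -[n [v av]]; apply: nex; exists n, v.
have pM := r_max_prime mM.
have hM : no_prime_below M by move=> P pP PM ntP; exact: fg_radicals_dim1.
have aM n v : radical_quotient_iter n a v -> M v.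
  by move=> av; apply: UM; exists n, v; split=> //; exact: mults_refl.
have [b [c [nb eb _ rb]]] := radical_generator RP na.
have Mb : M b by apply: (generator_in_prime eb pM); exact: (aM 0%N).
have [s [n [Ms]]] := divides_uniformizer_power pM hM Mb na.
clear nex U rU UM c eb Mb.
elim: n a s na Ms aM => [|n IHn] a s na Ms aM /multsP[h e].
  apply: Ms; move: e; rewrite expg0 mulg1 => ->.
  by apply: (r_idealM _ pM.1); exact: (aM 0%N).
have [c qc] := radical_quotient_exists RP na; have [d [rd ea]] := qc.
have Md : M d by apply: (generator_in_prime rd pM); exact: (aM 0%N).
have [t Mt /multsP[g f]] := uniformizer_divides pM hM nb rb Md.
apply: (IHn c (t * s)); first exact: radical_quotient_nz qc.
- exact: (prime_rMn pM).
- by move=> m v cv; apply: (aM m.+1); exists c.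
apply/multsP; exists (g * h); apply: (nonzero_mulgI nb).
have -> : b * (t * s * b ^+ n) = t * (s * b ^+ n.+1).
  by rewrite expgS -[t * s * _]mulgA [LHS]mulgCA; congr (_ * _); exact: mulgCA.
by rewrite e ea -(mulgA d) [LHS]mulgA f -[LHS]mulgA; congr (_ * _);
  exact: mulgCA.
Qed.

Lemma dividing_set d (E : seq H) : [set` E] `<=` mults d ->
  exists E' : seq H, [set` E] = mul d @` [set` E'].
Proof.
elim: E => [|x E IHE] dE; first by exists [::]; apply/seteqP; split=> [y|t [y]].
have [|E' e] := IHE; first by move=> y yE; apply: dE; rewrite /= inE;
  apply/orP; right.
have /multsP[h ex] : mults d x by apply: dE; rewrite /= inE eqxx.
exists (h :: E'); apply/seteqP; split=> [y /=|_ [y /= yE' <-]].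
  rewrite inE => /orP[/eqP->|yE]; first by exists h; rewrite ?inE ?eqxx.
  have : (mul d @` [set` E']) y by rewrite -e.
  by move=> [z zE' <-]; exists z => //=; rewrite inE; apply/orP; right.
move: yE'; rewrite !inE => /orP[/eqP->|yE']; first by rewrite ex eqxx.
apply/orP; right; have : (mul d @` [set` E']) (d * y) by exists y.
by rewrite -e.
Qed.

(** Division of a finitely generated ideal by the generator of its radical, [n]
    times over.  The product [c] of the divisors remembers the last one as its
    own [n]-th iterate [u], and this last one being a unit means that nothing
    is left of the ideal. *)
Lemma fg_division n (E : seq H) : fg_radicals_principal ->
  nontrivial (r [set` E]) ->
  exists c u, [/\ r [set` E] `<=` mults c, radical_quotient_iter n c u
    & mults u 1 -> principal (r [set` E])].
Proof.
move=> fg; elim: n E => [|n IHn] E ntE.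
all: have rE : r_ideal r (r [set` E]) by exact: r_ideal_closure.
all: have zE := r_ideal_zeros rE.
all: have [|d nd ed] := principal_nontrivial (fg _ rE (r_fg_seq E));
  first by (apply/nontrivialP; [exact: subset_trans zE (@sub_radical _ _)|
    have [x Ex nx] := (nontrivialP zE).1 ntE; exists x => //;
      exact: sub_radical]).
all: have Ed : r [set` E] `<=` mults d by rewrite -ed; exact: sub_radical.
  exists d, d; split=> // d1.
  have [m m0] : radical (r [set` E]) 1 by rewrite ed.
  rewrite expg1n => E1; rewrite (_ : r _ = mults 1);
    first exact: principal_mults.
  apply/seteqP; split=> x _; first exact: mults1.
  by rewrite -(mul1g x); exact: (r_idealM _ rE).
have [E' eE] := dividing_set (subset_trans (@sub_closure _ r _) Ed).
have rEE : r [set` E] = mul d @` r [set` E'] by rewrite closureZ eE.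
have rE' : r_ideal r (r [set` E']) by exact: r_ideal_closure.
have ntE' : nontrivial (r [set` E']).
  apply/(nontrivialP (r_ideal_zeros rE')).
  have [x + nx] := (nontrivialP zE).1 ntE; rewrite rEE => -[y Ey exy].
  by exists y => //; move: nx; rewrite -exy; exact: nzMr.
have [c [u [Ec cu pu]]] := IHn _ ntE'.
have Edc : r [set` E] `<=` mults (d * c).
  by rewrite rEE => _ [x Ex <-]; apply: mults_mul2; exact: Ec.
exists (d * c), u; split=> //.
  exists c => //; exists d; split=> //; apply/seteqP; split; last first.
    by rewrite -ed; exact: radical_mono.
  rewrite -[X in _ `<=` X](_ : radical (mults d) = _); last by rewrite -ed;
    exact: radical_idem.
  by apply: radical_mono; apply: mults_sub; exact: mults_mul.
move=> /pu pE'; have [e ne ee] := principal_nontrivial pE' ntE'.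
rewrite rEE ee (_ : _ @` _ = mults (d * e)); first exact: principal_mults.
apply/seteqP; split=> [_ [_ [h _ <-] <-]|_ [h _ <-]];
  first by rewrite /= mulgA; exact: mults_mul.
by exists (e * h); rewrite /= ?mulgA //; exact: mults_mul.
Qed.

Lemma fg_radicals_Bezout : fg_radicals_principal -> r_Bezout_monoid r.
Proof.
move=> fg I rI ntI [_ [/finite_seqP[E ->] _ eI]]; move: rI ntI;
  rewrite eI => rE ntE.
have [a Ea na] := (nontrivialP (r_ideal_zeros rE)).1 ntE.
have [n [v [av v1]]] := iter_reaches_unit fg na.
have [c [u [Ec cu]]] := fg_division n fg ntE; apply.
by apply: mults_trans v1; apply: (iter_mono na (Ec _ Ea) cu av).
Qed.

Lemma Bezout_gcd I x y : r_Bezout_monoid r -> r_ideal r I -> ~ zeros H x ->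
  I x -> I y -> exists g, [/\ I g, ~ zeros H g, mults g x & mults g y].
Proof.
move=> bz rI nx Ix Iy; pose J := r [set` [:: x; y]].
have rJ : r_ideal r J by exact: r_ideal_closure.
have [Jx Jy] : J x /\ J y by split; apply: sub_closure;
  rewrite /= !inE eqxx ?orbT.
have ntJ : nontrivial J by apply/(nontrivialP (r_ideal_zeros rJ)); exists x.
have [g ng e] := principal_nontrivial (bz J rJ ntJ (r_fg_seq _)) ntJ.
exists g; split=> //; try by rewrite -e.
have : J g by rewrite e; exact: mults_refl.
by apply: (r_ideal_sub rI) => t /=; rewrite !inE => /orP[]/eqP->.
Qed.

(** The ideal by which [radical I] has to be multiplied to get [I] back: the
    union of the principal ideals of radical quotients of members of [I],
    directed because common divisors exist within [I]. *)
Definition radical_colon I : set H :=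
  [set w | exists x c, [/\ I x, ~ zeros H x, radical_quotient x c & mults c w]].

Lemma r_ideal_radical_colon I : r_Bezout_monoid r -> principal_radicals H ->
  r_ideal r I -> nontrivial I -> r_ideal r (radical_colon I).
Proof.
move=> bz RP rI ntI; apply: r_ideal_directed => s.
suff dir : [set` s] `<=` radical_colon I -> exists x c,
    [/\ I x, ~ zeros H x, radical_quotient x c & [set` s] `<=` mults c].
  move=> /dir[x [c [Ix nx qc sc]]]; exists (mults c); split=> //.
    exact: r_ideal_mults.
  by move=> w cw; exists x, c.
elim: s => [|w s IHs] sI.
  have [x Ix nx] := (nontrivialP (r_ideal_zeros rI)).1 ntI.
  by have [c qc] := radical_quotient_exists RP nx; exists x, c.
have [|x [c [Ix nx qc sc]]] := IHs.
  by move=> y ys; apply: sI; rewrite /= inE; apply/orP; right.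
have [y [e [Iy ny qe ew]]] : radical_colon I w by apply: sI;
  rewrite /= inE eqxx.
have [g [Ig ng gx gy]] := Bezout_gcd bz rI nx Ix Iy.
have [k qk] := radical_quotient_exists RP ng; exists g, k; split=> // z /=.
rewrite inE => /orP[/eqP->|/sc].
  by apply: mults_trans ew; exact: radical_quotient_mono qk qe.
by apply: mults_trans; exact: radical_quotient_mono qk qc.
Qed.

(** Given [w ^+ n] and [x] in [I], a common divisor of both in [I] has its radical
    dividing [w] and its radical quotient dividing that of [x], so it divides
    the product of [w] with the latter. *)
Lemma radical_mul_colon I : r_Bezout_monoid r -> principal_radicals H ->
  r_ideal r I -> I = r (mulset (radical I) (radical_colon I)).
Proof.
move=> bz RP rI; apply/seteqP; split=> [x Ix|].
  have [zx|nx] := pselect (zeros H x).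
    by apply: r_ideal_zeros zx; exact: r_ideal_closure.
  have [c qc] := radical_quotient_exists RP nx; have [d [rd ex]] := qc.
  apply: sub_closure; exists d; last first.
    by exists c => //; exists x, c; split=> //; exact: mults_refl.
  apply: (radical_mono (r_ideal_mults_sub rI Ix)); rewrite rd;
    exact: mults_refl.
apply: r_ideal_sub => // _ [w [n n0 Iw] [k [x [c [Ix nx qc ck]]] <-]].
have [g [Ig ng gx gw]] := Bezout_gcd bz rI nx Ix Iw.
have [c' qc'] := radical_quotient_exists RP ng; have [d' [rd' eg]] := qc'.
apply: (r_ideal_mults_sub rI Ig); rewrite eg; apply: mults_mulM.
  by rewrite -rd'; exists n.
by apply: mults_trans ck; exact: radical_quotient_mono qc' qc.
Qed.

(** Induction on [n] applies to [radical_colon I], which contains the radical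
    quotient of [a]. *)
Lemma radical_factorization n I a v : r_Bezout_monoid r ->
  principal_radicals H ->
  r_ideal r I -> I a -> ~ zeros H a -> radical_quotient_iter n a v ->
    mults v 1 ->
  exists2 s : seq (set H),
    (forall J, J \in s -> r_ideal r J /\ is_radical J) & I = r (prodset s).
Proof.
move=> bz RP; elim: n I a => [|n IHn] I a rI Ia na /=.
  move=> -> a1; exists [::] => //; rewrite /prodset big_nil closure1.
  rewrite mults_setT; last exact: mults1.
  apply/seteqP; split=> // x _; apply: (r_ideal_mults_sub rI Ia).
  by rewrite (mults_setT a1).
move=> [c qc cv] v1.
have ntI : nontrivial I by apply/(nontrivialP (r_ideal_zeros rI)); exists a.
have Ic : radical_colon I c by exists a, c; split=> //; exact: mults_refl.
have [s sP es] := IHn _ c (r_ideal_radical_colon bz RP rI ntI) Ic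
  (radical_quotient_nz na qc) cv v1.
exists (radical I :: s) => [J|].
  rewrite inE => /orP[/eqP->|/sP//]; split; first exact: r_ideal_radical.
  exact: radical_idem.
by rewrite {1}(radical_mul_colon bz RP rI) {1}es closure_mulr /prodset big_cons.
Qed.

Lemma fg_radicals_SP : fg_radicals_principal -> r_SP_monoid r.
Proof.
move=> fg I rI; have zI := r_ideal_zeros rI.
have [ntI|tI] := pselect (nontrivial I).
  have [a Ia na] := (nontrivialP zI).1 ntI.
  have [n [v [av v1]]] := iter_reaches_unit fg na.
  exact: (radical_factorization (fg_radicals_Bezout fg) (fg_principal_radicals
    fg) rI Ia na av v1).
exists [:: I] => [J|]; last by rewrite /prodset big_cons big_nil mulset1.
rewrite inE => /eqP->; split=> //; rewrite (trivialP zI tI);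
  exact: radical_zeros.
Qed.

End DimensionOne.

(** * Factors of principal ideals in Bezout monoids *)

Section Bezout.
Local Open Scope group_scope.
Variables (H : cancMonoidType) (r : finitary_ideal_system H).
Implicit Types (a b c d e f g h i j k p s t u x y z : H)
  (X Y I J K P Q M : set H).

Lemma seq_sub_mulset X Y (E : seq H) : [set` E] `<=` mulset X Y ->
  exists F G : seq H, [/\ [set` F] `<=` X, [set` G] `<=` Y
    & [set` E] `<=` mulset [set` F] [set` G]].
Proof.
elim: E => [|e E IHE] EXY; first by exists [::], [::]; split=> x.
have [|F [G [FX GY EFG]]] := IHE.
  by move=> x xE; apply: EXY; rewrite /= inE; apply/orP; right.
have [x Xx [y Yy exy]] : mulset X Y e by apply: EXY; rewrite /= inE eqxx.
exists (x :: F), (y :: G); split=> z /=; rewrite inE => /orP[/eqP->//|].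
- exact: FX.
- exact: GY.
- by rewrite -exy; exists x; [|exists y]; rewrite //= inE eqxx.
- by move=> /EFG[u uF [v vG <-]]; exists u; [|exists v]; rewrite //= inE;
    apply/orP; right.
Qed.

(** If [a] already lies in [r (F G)] for finite [F] in [J] and [G] in [K] then, for
    [j] in [J], [j * a] lies in [r (F (j G))], which is contained in [a r(F)];
    cancelling [a], the set [F] generates [J]. *)
Lemma factor_finitely_generated a J K : r_ideal r J -> ~ zeros H a ->
  mults a = r (mulset J K) -> r_finitely_generated r J.
Proof.
move=> rJ na e; have : r (mulset J K) a by rewrite -e; exact: mults_refl.
move=> /closure_seq[E /seq_sub_mulset[F [G [FJ GK EFG]]] /(closure_mono EFG)
  ra].
exists [set` F]; split=> //; apply/seteqP; split; last exact: r_ideal_sub.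
move=> j Jj; have := closure_mulz j ra.
have sub : mul j @` mulset [set` F] [set` G] `<=` mul a @` r [set` F].
  move=> _ [_ [x Fx [y Gy <-]] <-].
  have /multsP[h eh] : mults a (j * y).
    by rewrite e; apply: sub_closure; exists j => //; exists y => //; exact: GK.
  exists (x * h); last by rewrite /= [RHS]mulgCA eh mulgCA.
  by apply: (r_idealM _ (r_ideal_closure r _)); exact: sub_closure.
move/(closure_mono sub); rewrite closureZ r_ideal_closure -closureZ => -[k rk].
by rewrite /= mulgC [j * a]mulgC => /(_ =P _)/eqP;
  rewrite mulgC => /(nonzero_mulgI na) <-.
Qed.

Lemma factor_principal a J K : r_Bezout_monoid r -> r_ideal r J ->
  ~ zeros H a ->
  mults a = r (mulset J K) -> exists2 b, ~ zeros H b & J = mults b.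
Proof.
move=> bz rJ na e.
have ntJ : nontrivial J.
  apply: contrapT => /(trivialP (r_ideal_zeros rJ)) eJ; apply: na.
  have : mults a a by exact: mults_refl.
  rewrite e -eJ; apply: r_ideal_sub => // _ [x + [y _ <-]].
  by rewrite eJ; exact: zerosMl.
by apply: principal_nontrivial => //; apply: bz => //;
  exact: factor_finitely_generated e.
Qed.

Lemma factors_principal a (s : seq (set H)) : r_Bezout_monoid r ->
  ~ zeros H a ->
  (forall J, J \in s -> r_ideal r J) -> mults a = r (prodset s) ->
  forall J, J \in s -> exists b, J = mults b.
Proof.
move=> bz; elim: s a => [|K s IHs] a na sr //; rewrite /prodset big_cons => e J.
have rK : r_ideal r K by apply: sr; rewrite inE eqxx.
rewrite inE => /orP[/eqP->|Js].
  by have [b _ ->] := factor_principal bz rK na e; exists b.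
move: e; rewrite mulsetC -closure_mull.
move=> /(factor_principal bz (r_ideal_closure r _) na)[b nb eb].
by apply: (IHs b) => // L Ls; apply: sr; rewrite inE Ls orbT.
Qed.

Lemma mulset_mults a b : mulset (mults a) (mults b) = mults (a * b).
Proof.
apply/seteqP; split=> [_ [x ax [y by_ <-]]|_ [h _ <-]]; first exact: mults_mulM.
by exists a; [exact: mults_refl|exists (b * h); rewrite ?mulgA//;
  exact: mults_mul].
Qed.

Lemma prodset_mults J (s : seq (set H)) :
  (forall K, K \in J :: s -> exists b, K = mults b) ->
  exists b, prodset (J :: s) = mults b.
Proof.
elim: s J => [|K s IHs] J Js;
  have [a ea] : exists b, J = mults b by apply: Js; rewrite inE eqxx.
  by exists a; rewrite /prodset big_cons big_nil mulset1.
have [|b eb] := IHs K; first by move=> L Ls; apply: Js; rewrite inE Ls orbT.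
by exists (a * b); rewrite /prodset big_cons -/(prodset _) eb ea mulset_mults.
Qed.

Lemma SP_radical_factorial : r_Bezout_monoid r -> r_SP_monoid r ->
  radical_factorial H.
Proof.
move=> bz sp I pI.
have zI : zeros H `<=` I by case/principalP: pI => [->|[a ->]]//;
  exact: zeros_mults.
have [ntI|/(trivialP zI) eI] := pselect (nontrivial I); last first.
  exists [:: I] => [J|]; last by rewrite /prodset big_cons big_nil mulset1.
  by rewrite inE => /eqP->; split=> //; rewrite eI; exact: radical_zeros.
have [a na eI] := principal_nontrivial pI ntI; rewrite eI.
have [s sP es] := sp _ (r_ideal_mults r a).
have sr J : J \in s -> r_ideal r J by move=> /sP[].
have sm := factors_principal bz na sr es.
case: s => [|J s] in sP es sr sm *.
  exists [:: mults a] => [J|];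
    last by rewrite /prodset big_cons big_nil mulset1.
  rewrite inE => /eqP->; split; first exact: principal_mults.
  rewrite es /prodset big_nil closure1; apply/seteqP; split;
    last exact: sub_radical.
  by move=> x _; exact: mults1.
exists (J :: s) => [K Ks|].
  by have [b eb] := sm K Ks; have [_ rK] := sP K Ks; split=> //; rewrite eb;
    exact: principal_mults.
by rewrite es; have [b ->] := prodset_mults sm; rewrite r_ideal_mults.
Qed.

(** For [x] in [P] only and [y] in [Q] only, a generator [d] of the ideal of [x] and
    [y] is in neither prime, so the cofactors [x / d] and [y / d] are in [P] and
    [Q], hence in [M]; but together they generate [H]. *)
Lemma Bezout_treed : r_Bezout_monoid r -> r_treed r.
Proof.
move=> bz M mM P Q pP pQ PM QM; apply: contrapT => /not_orP[nPQ nQP].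
have wit X Y : ~ X `<=` Y -> exists2 x, X x & ~ Y x.
  by move=> n; apply: contrapT => nex; apply: n => x Xx;
    apply: contrapT => nx; apply: nex; exists x.
have [x Px nQx] := wit _ _ nPQ; have [y Qy nPy] := wit _ _ nQP.
have nx : ~ zeros H x by move=> /(r_ideal_zeros pQ.1).
pose J := r [set` [:: x; y]].
have rJ : r_ideal r J by exact: r_ideal_closure.
have [Jx Jy] : J x /\ J y by split; apply: sub_closure;
  rewrite /= !inE eqxx ?orbT.
have ntJ : nontrivial J by apply/(nontrivialP (r_ideal_zeros rJ)); exists x.
have [d nd e] := principal_nontrivial (bz J rJ ntJ (r_fg_seq r _)) ntJ.
have /multsP[x' ex] : mults d x by rewrite -e.
have /multsP[y' ey] : mults d y by rewrite -e.
have Px' : P x'.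
  have := Px; rewrite ex => /(prime_rM pP)[Pd|//].
  by case: nPy; rewrite ey; exact: (r_idealM _ pP.1).
have Qy' : Q y'.
  have := Qy; rewrite ey => /(prime_rM pQ)[Qd|//].
  by case: nQx; rewrite ex; exact: (r_idealM _ pQ.1).
have pM := r_max_prime mM; apply: (prime_r1 pM).
have : J d by rewrite e; exact: mults_refl.
have sub : [set` [:: x; y]] `<=` mul d @` [set` [:: x'; y']].
  by move=> t /=; rewrite !inE => /orP[]/eqP->; [exists x'|exists y'];
    rewrite //= !inE eqxx ?orbT.
move=> /(closure_mono sub); rewrite -closureZ => -[k rk].
rewrite -{2}[d]mulg1 => /(nonzero_mulgI nd) <-.
apply: (r_ideal_sub pM.1 _ rk) => t /=; rewrite !inE => /orP[]/eqP->.
  exact: PM.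
exact: QM.
Qed.

Lemma prime_sub_prodset P (s : seq (set H)) : prime_s_ideal P ->
  prodset s `<=` P -> exists2 J, J \in s & J `<=` P.
Proof.
move=> pP; elim: s => [|J s IHs]; rewrite /prodset.
  by rewrite big_nil => /(_ 1 erefl)/(prime_s1 pP).
rewrite big_cons => JsP; have [JP|nJP] := pselect (J `<=` P).
  by exists J; rewrite ?inE ?eqxx.
have [|K Ks KP] := IHs; last by exists K; rewrite // inE Ks orbT.
move=> y sy; apply: contrapT => nPy; apply: nJP => x Jx.
by have [_ _ /(_ x y)[|//|//]] := pP; apply: JsP; exists x => //; exists y.
Qed.

Lemma prodset_zeros (s : seq (set H)) : zeros H \in s -> prodset s `<=` zeros H.
Proof.
elim: s => // J s IHs; rewrite inE /prodset big_cons => /orP[/eqP<-|/IHs zs].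
  by move=> _ [x zx [y _ <-]]; exact: zerosMl.
by move=> _ [x _ [y /zs zy <-]]; exact: zerosMr.
Qed.

Lemma radical_factorial_prime P : radical_factorial H -> prime_s_ideal P ->
  nontrivial P -> exists I,
    [/\ principal I, nontrivial I, is_radical I & I `<=` P].
Proof.
move=> rf pP ntP; have [a Pa na] := (nontrivialP (prime_s_zeros pP)).1 ntP.
have [s sP es] := rf _ (principal_mults a).
have [|J Js JP] := @prime_sub_prodset P s pP.
  by rewrite -es => _ [h _ <-]; exact: prime_sM.
have [pJ rJ] := sP J Js; exists J; split=> //; apply: contrapT => tJ.
have eJ : J = zeros H.
  by apply: trivialP => //; case/principalP: pJ => [->|[b ->]]//;
    exact: zeros_mults.
apply: na; have : mults a a by exact: mults_refl.
by rewrite es; apply: prodset_zeros; rewrite -eJ.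
Qed.

End Bezout.

(** * Invertible ideals and the class group *)

Section Invertible.
Local Open Scope group_scope.
Variables (H : cancMonoidType) (r : finitary_ideal_system H).
Implicit Types (a b c d e f g h i j k p s t u x y z : H)
  (X Y I J K P Q M U : set H).

Lemma frac_exists s p : ~ zeros H s ->
  exists z : quotient_monoid H, tofrac s * z = tofrac p.
Proof.
move=> ns; have Ss : (p, s).2 \in @nonzero H by apply/asboolP.
exists (\pi_(quotient_monoid H)%qT (Prefrac Ss)).
rewrite [LHS]pi_mul; apply/eqmodP/asboolP; exists 1; rewrite ?gpred1 //=.
by rewrite !mul1g mulg1 mulgC.
Qed.

(** Fractions [p / s] multiplying [X] into [H], spelled out within [H]. *)
Lemma mul_inv_setP X t : mul_inv_set X t <->
  exists i p s, [/\ X i, ~ zeros H s, s * t = i * p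
                  & forall x, X x -> mults s (p * x)].
Proof.
split.
  move=> [_ [i Xi <-] [z iz e]].
  have [s [p [/asboolP ns esp]]] := loc_clear z.
  have {}esp : tofrac s * z = tofrac p by [].
  exists i, p, s; split=> //.
    by apply: (@tofrac_inj H);
      rewrite !tofracM -e -esp mulgA [RHS]mulgA (mulgC (tofrac s)).
  move=> x Xx; have [g _ eg] : range (@tofrac H) (z * tofrac x).
    by apply: iz; exists (tofrac x) => //; exists x.
  apply/multsP; exists g; apply: (@tofrac_inj H).
  by rewrite !tofracM eg -esp mulgA.
move=> [i [p [s [Xi ns e sX]]]]; have [z ez] := frac_exists p ns.
have Ss : s \in @nonzero H by apply/asboolP.
have injs := @loc_embed_inj_mul _ _ s Ss.
exists (tofrac i); first by exists i.
exists z; last first.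
  apply: injs; change (tofrac s * (tofrac i * z) = tofrac s * tofrac t).
  by rewrite -tofracM e tofracM -ez mulgA [RHS]mulgA (mulgC (tofrac s)).
move=> _ [_ [x Xx <-] <-]; have /multsP[g eg] := sX x Xx; exists g => //.
apply: injs; change (tofrac s * tofrac g = tofrac s * (z * tofrac x)).
by rewrite -tofracM -eg tofracM -ez mulgA.
Qed.

Lemma invertible_nontrivial I : r_ideal r I -> r_invertible r I -> nontrivial I.
Proof.
move=> rI iI; apply: contrapT => /(trivialP (r_ideal_zeros rI)) eI.
have : r (mul_inv_set I) 1 by rewrite iI.
move=> r1; apply: (@nz1 H); rewrite -eI; apply: (r_ideal_sub rI _ r1) => t.
move=> /mul_inv_setP[i [p [s [+ ns e _]]]]; rewrite eI => zi.
apply: contrapT => nt; apply: (nzM ns nt); rewrite e; exact: zerosMl.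
Qed.

(** Let [1] be in the closure of finitely many members [i * z] of [I * I^-1].  For
    [y] in [I] the products [y * (i * z)] are multiples of the elements [i], so
    these elements generate [I]. *)
Lemma invertible_finitely_generated I : r_ideal r I -> r_invertible r I ->
  r_finitely_generated r I.
Proof.
move=> rI iI; have : r (mul_inv_set I) 1 by rewrite iI.
move=> /closure_seq[F FI r1].
suff [E [EI EF]] : exists E : seq H, [set` E] `<=` I /\
    forall f, f \in F -> forall y, I y -> r [set` E] (y * f).
  exists [set` E]; split=> //; apply/seteqP; split; last exact: r_ideal_sub.
  move=> y Iy; have := closure_mulz y r1; rewrite mulg1.
  apply: r_ideal_sub; first exact: r_ideal_closure.
  by move=> _ [f fF <-]; exact: EF.
elim: F FI {r1} => [|f F IHF] FI; first by exists [::]; split=> // x.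
have [|E [EI EF]] := IHF.
  by move=> x xF; apply: FI; rewrite /= inE; apply/orP; right.
have /mul_inv_setP[i [p [s [Ii ns e sI]]]] : mul_inv_set I f.
  by apply: FI; rewrite /= inE eqxx.
exists (i :: E); split=> [x /=|g].
  by rewrite inE => /orP[/eqP->//|/EI].
rewrite inE => /orP[/eqP->|gF] y Iy; last first.
  apply: (closure_mono _ (EF g gF y Iy)) => x /= xE; rewrite inE; apply/orP;
    by right.
have /multsP[h eh] := sI y Iy.
have -> : y * f = i * h.
  apply: (nonzero_mulgI ns); rewrite /= mulgCA e [RHS]mulgCA -eh.
  by rewrite mulgCA (mulgC y).
by apply: (r_idealM _ (r_ideal_closure r _)); apply: sub_closure;
  rewrite /= inE eqxx.
Qed.

Lemma invertible_cancel U X Y : r_invertible r U -> r_ideal r Y ->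
  r (mulset U X) `<=` r (mulset U Y) -> X `<=` Y.
Proof.
move=> iU rY UXY x Xx; rewrite -(mulg1 x).
have : r (mul_inv_set U) 1 by rewrite iU.
move=> /(closure_mulz x);
  apply: (r_ideal_sub rY) => _ [t /mul_inv_setP[i [p [s [Ui ns e sU]]]] <-].
have : r (mulset U Y) (i * x).
  by apply: UXY; apply: sub_closure; exists i => //; exists x.
move=> /(closure_mulz p).
have sub : mul p @` mulset U Y `<=` mul s @` Y.
  move=> _ [_ [v Uv [y Yy <-]] <-]; have /multsP[g eg] := sU v Uv.
  by exists (y * g); [exact: (r_idealM _ rY)|rewrite /= [RHS]mulgA eg
    -[RHS]mulgA (mulgC y)].
move=> /(closure_mono sub); rewrite -closureZ rY => -[y Yy].
rewrite /= mulgA (mulgC p) -e -mulgA => /(nonzero_mulgI ns) ey.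
by rewrite mulgC -ey.
Qed.

(** Every element of the quotient group is a fraction of two invertible ideals, so
    all of them are principal fractions. *)
Lemma class_group_trivial_of_principal :
  (forall I, r_ideal r I -> r_invertible r I -> principal I) ->
    class_group_trivial r.
Proof.
move=> inv.
have pf (w : invertible_quotient_group r) : principal_fractions w.
  have [J [I [_ e]]] := loc_clear w; exists I, J.
  have [rI iI] := invertible_idealP I; have [rJ iJ] := invertible_idealP J.
  split; [exact: invertible_nontrivial|exact: inv|exact:
    invertible_nontrivial|exact: inv|].
  by rewrite mulgC.
have all (z : invertible_quotient_group r) :
  class_of z = @principal_fractions _ r.
  apply/seteqP; split=> [w _|w _]; first exact: pf.
  have [z' ez] : exists z' : invertible_quotient_group r, z * z' = 1.
    case: (repr z) (reprK z) => -[I J] /= SJ <-.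
    have SI : (J, I).2 \in @full_pred _ r by [].
    exists (\pi_(invertible_quotient_group r)%qT (Prefrac SI)).
    rewrite [LHS]pi_mul; apply/eqmodP/asboolP; exists 1 => //=.
    by rewrite !mul1g mulg1 mulgC.
  by exists (z' * w); [exact: pf|rewrite mulgA ez mul1g].
apply/seteqP; split=> [_ [z _ <-]|_ ->]; first exact: all.
by exists 1 => //; exact: all.
Qed.

(** A principal fraction [I] satisfies [b I = a H] for some nonzero [a] and [b], and
    is then generated by [a / b], which lies in [H]. *)
Lemma class_group_trivial_principal I : class_group_trivial r ->
  r_ideal r I -> r_invertible r I -> principal I.
Proof.
move=> ct rI iI.
have SI : I \in invertible_pred r by apply/asboolP.
pose I' : invertible_ideal r := InvertibleIdeal SI.
have pf1 : @principal_fractions _ r 1.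
  have nt1 : nontrivial (one_ideal r).
    by apply/nontrivialP => //=; exists 1 => //; exact: nz1.
  have p1 : principal (one_ideal r).
    rewrite (_ : ideal_set _ = mults 1); first exact: principal_mults.
    by rewrite mults_setT //; exact: mults1.
  by exists (one_ideal r), (one_ideal r); split=> //; rewrite mul1g.
have : @class_group _ r (class_of (loc_embed (@full_pred _ r) I')) by exists
  (loc_embed (@full_pred _ r) I').
rewrite ct => /= ec; have :
  class_of (loc_embed (@full_pred _ r) I') (loc_embed (@full_pred _ r) I').
  by exists 1 => //; rewrite mulg1.
rewrite ec => -[A [B [ntA pA ntB pB]]].
rewrite -loc_embedM => /eqmodP/asboolP[U _]; rewrite /= !mulg1.
move=> /(congr1 (@ideal_set _ _)) /= eU.
have [a na ea] := principal_nontrivial pA ntA.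
have [b nb eb] := principal_nontrivial pB ntB.
have [rU iU] := invertible_idealP U.
have [rA _] := invertible_idealP A.
have e : r (mulset I B) = A.
  by apply/seteqP; split; apply: (invertible_cancel iU);
    rewrite ?eU //; exact: r_ideal_closure.
have eI : r (mulset I B) = mul b @` I.
  rewrite mulsetC eb -(closure1 r) closure_mull -[in RHS]rI closureZ;
    congr (r _).
  by apply/seteqP; split=> [_ [_ -> [x Ix <-]]|_ [x Ix <-]];
    [exists x|exists b => //; exists x].
have [c Ic ec'] : (mul b @` I) a by rewrite -eI e ea; exact: mults_refl.
rewrite (_ : I = mults c); first exact: principal_mults.
apply/seteqP; split; last exact: (r_ideal_mults_sub rI).
move=> x Ix; apply: (mults_pmul nb); rewrite [b * c]ec' -ea -e eI.
by exists x.
Qed.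

End Invertible.

(** * Treed monoids whose primes contain radical elements *)

Section AlmostDedekind.
Local Open Scope group_scope.
Variables (H : cancMonoidType) (r : finitary_ideal_system H).
Implicit Types (a b c d e g h m p s t u x y z : H)
  (X Y I J P Q M : set H).

(** Let [b] be radical and [m] in [M] outside a prime [P] containing [b].  Since
    primes of [M] are comparable, those containing [m] contain [b], so that
    [m] divides a power of [b] locally; and a factor [h] of a local multiple
    [m * h] of [b] lies in all the primes of [M] containing [b], so is itself
    locally a multiple of [b].  Cancelling [b] repeatedly makes [m] a unit. *)
Lemma treed_radical_max M b P : r_treed r -> r_max r M -> ~ zeros H b ->
  is_radical (mults b) -> prime_r_ideal r P -> P `<=` M -> P b -> P = M.
Proof.
move=> tr mM nb rb pP PM Pb; apply/seteqP; split=> // m Mm.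
apply: contrapT => nPm; have pM := r_max_prime mM.
have [|s [n [Ms /multsP[h e]]]] := local_radical (r := r) (x := b) (y :=
  m) pM.2.
  move=> P' pP' P'M P'm; have [PP'|P'P] := tr _ mM _ _ pP pP' PM P'M;
    first exact: PP'.
  by case: nPm; exact: P'P.
elim: n s h Ms e => [|n IHn] s h Ms e.
  apply: Ms; move: e; rewrite expg0 mulg1 => ->; exact: (r_idealM _ pM.1).
have mhX X : r_ideal r X -> X b -> X (m * h).
  by move=> rX Xb; rewrite -e expgS mulgCA; exact: (r_idealM _ rX).
have Ph : P h by have := mhX P pP.1 Pb => /(prime_rM pP)[].
have [|t Mt /multsP[g f]] := local_radical_mults (r := r) (x := h) pM.2 rb.
  move=> P1 pP1 P1M P1b; have [PP1|P1P] := tr _ mM _ _ pP pP1 PM P1M;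
    first exact: PP1.
  by have := mhX P1 pP1.1 P1b => /(prime_rM pP1)[/P1P|].
apply: (IHn (t * s) g); first exact: (prime_rMn pM).
apply: (nonzero_mulgI nb); rewrite [RHS]mulgCA -f [RHS]mulgCA -e expgS.
by rewrite -[t * s * _]mulgA [LHS]mulgCA; congr (_ * _); exact: mulgCA.
Qed.

Definition primes_contain_radicals := forall P : set H,
  prime_r_ideal r P -> nontrivial P -> exists I : set H,
    [/\ principal I, nontrivial I, is_radical I & I `<=` P].

Lemma radical_element P : primes_contain_radicals -> prime_r_ideal r P ->
  nontrivial P -> exists b, [/\ P b, ~ zeros H b & is_radical (mults b)].
Proof.
move=> hr pP ntP; have [I [pI ntI rI IP]] := hr P pP ntP.
have [b nb eb] := principal_nontrivial pI ntI; exists b; split=> //.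
  by apply: IP; rewrite eb; exact: mults_refl.
by rewrite -eb.
Qed.

Lemma treed_no_prime_below Q : r_treed r -> primes_contain_radicals ->
  prime_r_ideal r Q -> no_prime_below r Q.
Proof.
move=> tr hr pQ P pP PQ ntP; have [M mM QM] := r_max_exists pQ.1 (prime_r1 pQ).
have [b [Pb nb rb]] := radical_element hr pP ntP.
have -> : P = M by apply: (treed_radical_max tr mM nb rb pP) => // x /PQ/QM.
by rewrite (treed_radical_max tr mM nb rb pQ QM (PQ _ Pb)).
Qed.

(** For [J] the radical of [a H] and [M] maximal over [a], let [s * b ^+ n = a * h]
    with [s] and [h] outside [M].  Then [h / b] maps [J] into [H] and [s * b] lies
    in [J], so that [J * J^-1] contains [s * h] and is not inside [M]. *)
Lemma radical_invertible a : r_treed r -> primes_contain_radicals ->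
  ~ zeros H a -> r_invertible r (radical (mults a)).
Proof.
move=> tr hr na; set J := radical _.
have rJ : r_ideal r J by exact/r_ideal_radical/r_ideal_mults.
apply: contrapT => nT.
have rI := r_ideal_closure r (mul_inv_set J).
have n1 : ~ r (mul_inv_set J) 1 by exact/(proper1 rI).
have [M mM IM] := r_max_exists rI n1.
have pM := r_max_prime mM.
have IM' t : mul_inv_set J t -> M t by move=> ?; apply: IM; exact: sub_closure.
have Ma : M a.
  apply: IM'; apply/mul_inv_setP; exists a, 1, 1; split=> //.
  - exact/sub_radical/mults_refl.
  - exact: nz1.
  - by rewrite mul1g mulg1.
  - by move=> x _; exact: mults1.
have hM := treed_no_prime_below tr hr pM.
have [b [Mb nb rb]] := radical_element hr pM (prime_nontrivial pM Ma na).
have [s [h [n [Ms Mh e]]]] := associate_uniformizer_power pM hM Mb nb rb na.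
case: n e => [|n] e.
  by apply: Ms; move: e; rewrite expg0 mulg1 => ->; exact: (r_idealM _ pM.1).
apply: (prime_rMn pM Ms Mh); apply: IM'; apply/mul_inv_setP.
exists (s * b), h, b; split=> //.
- exists n.+1 => //; rewrite expgMc expgSr -mulgA e mulgCA.
  exact: mults_mul.
- by rewrite mulgA (mulgC b).
- move=> y [k k0 /multsP[g ey]]; apply: (is_radicalP (n := k)) => //.
  case: k k0 ey => // k _ ey; rewrite expgMc ey expgS.
  by rewrite mulgACA (mulgC h) -e expgS (mulgCA s) -mulgA; exact: mults_mul.
Qed.

(** Contraction to [H] of the ideal generated by [c] in the localization at [Q]. *)
Definition local_mults Q c : set H :=
  [set x | exists2 s, ~ Q s & mults c (s * x)].

Lemma r_ideal_local_mults Q c : prime_r_ideal r Q ->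
  r_ideal r (local_mults Q c).
Proof.
move=> pQ; apply: r_ideal_directed => E EQ.
suff [s Qs Es] : exists2 s, ~ Q s & [set` E] `<=` colon (mults c) s.
  exists (colon (mults c) s); split=> //;
    first exact/r_ideal_colon/r_ideal_mults.
  by move=> x cx; exists s; rewrite // mulgC.
elim: E EQ => [|x E IHE] EQ; first by exists 1; [exact: (prime_r1 pQ)|move=> x].
have [|s Qs Es] := IHE.
  by move=> y yE; apply: EQ; rewrite /= inE; apply/orP; right.
have [t Qt cx] : local_mults Q c x by apply: EQ; rewrite /= inE eqxx.
exists (s * t); first exact: (prime_rMn pQ).
move=> y /=; rewrite inE /colon /= => /orP[/eqP->|/Es cy].
  by rewrite mulgCA mulgC (mulgC x); apply: multsM.
by rewrite mulgA; apply: multsM.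
Qed.

(** Below [Q] there is only the trivial prime, and the contraction of [b ^ 2] is
    [Q]-primary without being [Q]. *)
Lemma treed_primary_inclusive : r_treed r -> primes_contain_radicals ->
  primary_r_ideal_inclusive r.
Proof.
move=> tr hr P Q pP pQ [PQ nQP]; have hQ := treed_no_prime_below tr hr pQ.
have eP : P = zeros H.
  apply: (trivialP (r_ideal_zeros pP.1)) => ntP; apply: nQP.
  by rewrite (hQ P pP PQ ntP).
have ntQ : nontrivial Q by split; [exact: (r_ideal_zeros pQ.1)|rewrite -eP].
have [b [Qb nb rb]] := radical_element hr pQ ntQ.
pose I := local_mults Q (b * b).
have rI : r_ideal r I := r_ideal_local_mults (b * b) pQ.
have bbQ : mults (b * b) `<=` Q.
  by apply: (r_ideal_mults_sub pQ.1); exact: (r_idealM _ pQ.1).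
have IQ : I `<=` Q by move=> x [s Qs /bbQ/(prime_rM pQ)[]].
have RI : radical I = Q.
  apply/seteqP; split=> [|x Qx]; first exact: radical_sub_prime pQ.2 IQ.
  have [s Qs bx] := uniformizer_divides pQ hQ nb rb Qx.
  exists 2%N => //; exists (s * s); first exact: (prime_rMn pQ).
  by rewrite expg2 mulgACA; exact: mults_mulM.
have nIb : ~ I b.
  move=> [s Qs /multsP[h e]]; apply: Qs;
    suff -> : s = b * h by exact: (r_idealM _ pQ.1).
  by apply: (nonzero_mulgI nb); rewrite /= mulgC e mulgA.
exists I; rewrite RI; split=> //; last 2 first.
- by rewrite eP; exact: r_ideal_zeros rI.
- by split=> // /(_ _ Qb).
split=> //; split; [exact: r_ideal_s_ideal rI|by apply/(proper1 rI) =>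
  /IQ/(prime_r1 pQ)|].
move=> x y [s Qs sxy] nIx; rewrite RI; apply: contrapT => nQy; apply: nIx.
by exists (s * y); [exact: (prime_rMn pQ)|rewrite mulgAC -mulgA].
Qed.

Lemma powset_exp P x k : P x -> powset P k (x ^+ k).
Proof.
move=> Px; elim: k => [|k IHk]; first by rewrite powset0.
by rewrite powsetS expgS; exists x => //; exists (x ^+ k).
Qed.

Lemma powset_uniformizer P b k w : prime_r_ideal r P -> no_prime_below r P ->
  ~ zeros H b -> is_radical (mults b) -> powset P k w ->
  exists2 s, ~ P s & mults (b ^+ k) (s * w).
Proof.
move=> pP hP nb rb; elim: k w => [|k IHk] w.
  by rewrite powset0 => _; exists 1; [exact: prime_r1 pP|exact: mults1].
rewrite powsetS => -[x Px [y Py <-]].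
have [s Ps bx] := uniformizer_divides pP hP nb rb Px.
have [t Pt bky] := IHk y Py.
exists (s * t); first exact: (prime_rMn pP).
by rewrite expgS mulgACA; exact: mults_mulM.
Qed.

(** The exponent for a [P]-primary [I] is the least [k] with [b ^+ k] in [I]. *)
Lemma treed_prime_power : r_treed r -> primes_contain_radicals ->
  r_prime_power_condition r.
Proof.
move=> tr hr I pI; have [rI [_ /(proper1 rI) I1 Ip]] := pI.
have pP := primary_radical_prime pI; set P := radical I in pP *.
have [ntI|/(trivialP (r_ideal_zeros rI)) eI] := pselect (nontrivial I);
  last first.
  exists 1%N => //; rewrite powset1 /P eI radical_zeros -eI; exact: esym.
have [x0 Ix0 nx0] := (nontrivialP (r_ideal_zeros rI)).1 ntI.
have Px0 : P x0 by exact: sub_radical.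
have ntP := prime_nontrivial pP Px0 nx0.
have hP := treed_no_prime_below tr hr pP.
have [b [Pb nb rb]] := radical_element hr pP ntP.
have [m m0 Ibm] := Pb.
have exk : exists n, `[< I (b ^+ n) >] by exists m; apply/asboolP.
have [k /asboolP Ibk kmin] := ex_minnP exk.
have k0 : (0 < k)%N by case: k Ibk {kmin} => // /I1.
have cancelI s w : ~ P s -> I (s * w) -> I w.
  by move=> Ps Isw; apply: contrapT => nIw; apply/Ps/(Ip w) => //;
    rewrite mulgC.
have rPk := r_ideal_closure r (powset P k).
exists k => //; apply/seteqP; split; last first.
  apply: (r_ideal_sub rI) => w /(powset_uniformizer pP hP nb rb)[s Ps bw].
  by apply: (cancelI s) => //; exact: (r_ideal_mults_sub rI Ibk).
move=> x Ix; have [zx|nx] := pselect (zeros H x);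
  first exact: r_ideal_zeros rPk _ zx.
have [s [h [n [Ps Ph e]]]] := associate_uniformizer_power pP hP Pb nb rb nx.
have kn : (k <= n)%N.
  apply: kmin; apply/asboolP; apply: (cancelI s) => //; rewrite e.
  exact: (r_idealM _ rI).
have rC := r_ideal_colon x rPk.
apply: contrapT => nx';
  have C1 : ~ colon (r (powset P k)) x 1 by rewrite /colon /= mul1g.
have [M mM CM] := r_max_exists rC C1; have pM := r_max_prime mM.
have PM : P `<=` M.
  move=> p Pp; apply: (prime_sX (n := k) pM.2); apply: CM; rewrite /colon /=.
  by apply: (r_idealM _ rPk); apply: sub_closure; exact: powset_exp.
have eP := treed_no_prime_below tr hr pM pP PM ntP.
apply: Ph; rewrite eP; apply: CM; rewrite /colon /= mulgC -e mulgC.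
apply: (r_idealM _ rPk); apply: (exp_mem _ _ kn).
  by move=> y z; exact: (r_idealM _ rPk).
by apply: sub_closure; exact: powset_exp.
Qed.

Lemma treed_principal_radicals : r_treed r -> class_group_trivial r ->
  primes_contain_radicals -> principal_radicals H.
Proof.
move=> tr ct hr I pI.
have [->|[a ->]] := principalP pI; first by rewrite radical_zeros;
  exact: principal_zeros.
have [za|na] := pselect (zeros H a).
  by rewrite mults_zero// radical_zeros; exact: principal_zeros.
apply: (class_group_trivial_principal ct);
  first exact/r_ideal_radical/r_ideal_mults.
exact: radical_invertible.
Qed.

End AlmostDedekind.

(** * Equivalence of the conditions *)

Theorem theorem3p10 (H : cancMonoidType) (r : finitary_ideal_system H) :
  [<-> r_Bezout_monoid r /\ r_SP_monoid r;
       radical_factorial H /\ r_Bezout_monoid r;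
       [/\ r_treed r, class_group_trivial r
                   & forall P : set H, prime_r_ideal r P -> nontrivial P ->
                       exists I : set H,
                         [/\ principal I, nontrivial I, is_radical I
                           & I `<=` P]];
       [/\ r_prime_power_condition r, primary_r_ideal_inclusive r
                   & forall I : set H, principal I -> principal (radical I)];
       r_treed r /\
                 (forall I : set H, principal I -> principal (radical I));
       (forall I : set H, r_ideal r I -> nontrivial I ->
                    r_finitely_generated r I ->
                    minimal_primes I `<=` height_one_primes H) /\
                 (forall I : set H, principal I -> principal (radical I));
       forall I : set H, r_ideal r I -> r_finitely_generated r I ->
                   principal (radical I)].
Proof.
tfae.
- by move=> [bz sp]; split=> //; exact: SP_radical_factorial sp.
- move=> [rf bz]; split; first exact: Bezout_treed.
    apply: class_group_trivial_of_principal => I rI iI; apply: bz => //.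
      exact: invertible_nontrivial iI.
    exact: invertible_finitely_generated iI.
  by move=> P [_ pP]; exact: radical_factorial_prime.
- move=> [tr ct hr]; split; first exact: treed_prime_power.
    exact: treed_primary_inclusive.
  exact: (treed_principal_radicals tr ct hr).
- by move=> [pw inc RP]; split=> //; exact: prime_power_treed.
- by move=> [tr RP]; split=> // I; exact: treed_minimal_primes.
- by move=> [min1 RP] I; exact: height_one_radicals_principal.
- by move=> fg; split; [exact: fg_radicals_Bezout|exact: fg_radicals_SP].
Qed.
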